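(* Let $X$ be a minimal subshift. Then $X$ has nonsuperlinear-growth complexity, i.e. $\liminf_{n\to+\infty} p_X(n)/n < +\infty$, if and only if there exist $d > 0$ and an $\mathcal{S}$-adic sequence $\boldsymbol{\sigma} = (\sigma_n\colon \mathcal{A}_{n+1}\to\mathcal{A}_n^+)_{n\geq 0}$ generating $X$ such that, for every $n\geq 0$, the following hold: (P1) $\#\big(\mathrm{root}\,\sigma_{[0,n)}(\mathcal{A}_n)\big) \leq d$; (P2) $|\sigma_{[0,n)}(a)| \leq d\cdot|\sigma_{[0,n)}(b)|$ for all $a,b\in\mathcal{A}_n$.
   Context: An alphabet is a finite nonempty set $\mathcal{A}$; $\mathcal{A}^+$ is the set of nonempty finite words over $\mathcal{A}$, and $|w|$ is the length of a word $w$. The shift $S$ on $\mathcal{A}^{\mathbb{Z}}$ (product of discrete topologies) is $S((x_n)_n)=(x_{n+1})_n$. A subshift is a closed set $X\subseteq\mathcal{A}^{\mathbb{Z}}$ with $S(X)=X$; it is minimal if it is nonempty and contains no closed, $S$-invariant subset other than $\emptyset$ and $X$. $p_X(n)$ is the number of words of length $n$ that occur in at least one $x\in X$. A map $\tau\colon\mathcal{A}\to\mathcal{B}^+$ is extended by concatenation to $\mathcal{A}^+\to\mathcal{B}^+$. An $\mathcal{S}$-adic sequence is a sequence $\boldsymbol{\sigma}=(\sigma_n\colon\mathcal{A}_{n+1}\to\mathcal{A}_n^+)_{n\ge0}$ of such maps, where the $\mathcal{A}_n$ are alphabets. For $n\ge1$, $\sigma_{[0,n)}=\sigma_0\circ\sigma_1\circ\cdots\circ\sigma_{n-1}\colon\mathcal{A}_n\to\mathcal{A}_0^+$;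 $\sigma_{[0,0)}$ is the identity. The subshift generated by $\boldsymbol{\sigma}$ is $X_{\boldsymbol{\sigma}}\subseteq\mathcal{A}_0^{\mathbb{Z}}$, where $x\in X_{\boldsymbol{\sigma}}$ if and only if for every $\ell\geq0$ the word $x_{[-\ell,\ell)}=x_{-\ell}\cdots x_{\ell-1}$ occurs in $\sigma_{[0,n)}(a)$ for some $n\ge1$ and $a\in\mathcal{A}_n$. $\boldsymbol{\sigma}$ generates $X$ if $X_{\boldsymbol{\sigma}}=X$. For a nonempty word $u$, $\mathrm{root}\,u$ is the shortest prefix $v$ of $u$ such that $u=v^k$ for some $k\ge1$; for a set of words $\mathcal{W}$, $\mathrm{root}\,\mathcal{W}=\{\mathrm{root}\,w: w\in\mathcal{W}\}$. $\#$ denotes cardinality. *)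

(* Defs.v *)
From mathcomp Require Import all_boot all_order all_algebra finmap.
From mathcomp Require Import all_classical all_reals all_analysis.

Set Implicit Arguments.
Unset Strict Implicit.
Unset Printing Implicit Defensive.

Import Order.TTheory GRing.Theory Num.Theory.

Local Open Scope classical_set_scope.
Local Open Scope ring_scope.

Notation full_shift T := {ptws int -> discrete_topology T}.

Definition shift (T : finType) (x : full_shift T) : full_shift T :=
  fun n => x (n + 1).

Definition subshift (T : finType) (X : set (full_shift T)) : Prop :=
  closed X /\ @shift T @` X = X.

Definition minimal_subshift (T : finType) (X : set (full_shift T)) : Prop :=
  [/\ subshift X, X !=set0
    & forall Y : set (full_shift T),
        Y `<=` X -> closed Y -> @shift T @` Y = Y -> Y = set0 \/ Y = X].

(* factor x i n is the word x_i x_(i+1) ... x_(i+n-1) *)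
Definition factor (T : finType) (x : full_shift T) (i : int) (n : nat) : seq T :=
  mkseq (fun k => x (i + k%:Z)) n.

Definition complexity (T : finType) (X : set (full_shift T)) (n : nat) : nat :=
  #|[pred w : n.-tuple T |
      `[< exists2 x, X x & exists i : int, factor x i n = w >]]|.

(* At n = 0 the quotient is 0 by convention; this does not affect the liminf. *)
Definition nonsuperlinear_complexity (R : realType) (T : finType)
    (X : set (full_shift T)) : Prop :=
  (limn_einf (fun n : nat => ((complexity X n)%:R / n%:R : R)%:E) < +oo)%E.

(* The alphabets A_0, A_1, A_2, ... of a directive sequence with A_0 = T and
   A_(n+1) = B n; having A_0 definitionally equal to T avoids transports. *)
Definition alphabet (T : finType) (B : nat -> finType) (n : nat) : finType :=
  if n is m.+1 then B m else T.

Record sadic (T : finType) := Sadic {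
  sadic_tail : nat -> finType;
  sadic_alph := alphabet T sadic_tail;
  sadic_alph_gt0 : forall n, (0 < #|sadic_alph n|)%N;
  sadic_map : forall n, sadic_alph n.+1 -> seq (sadic_alph n);
  sadic_map_neq0 : forall n a, @sadic_map n a != [::]
}.

Definition word_ext (A B : Type) (tau : A -> seq B) (w : seq A) : seq B :=
  flatten (map tau w).

(* sigma_[0,n), already extended to words *)
Fixpoint sadic_prefix (T : finType) (s : sadic T) (n : nat) :
    seq (sadic_alph s n) -> seq T :=
  match n return seq (sadic_alph s n) -> seq T with
  | 0%N => fun w => w
  | m.+1 => fun w => sadic_prefix (word_ext (@sadic_map T s m) w)
  end.

(* sigma_[0,n)(a) for a letter a *)
Definition sadic_word (T : finType) (s : sadic T) (n : nat)
    (a : sadic_alph s n) : seq T :=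
  sadic_prefix [:: a].

Definition sadic_subshift (T : finType) (s : sadic T) : set (full_shift T) :=
  [set x | forall l : nat, exists2 n : nat, (1 <= n)%N &
     exists a : sadic_alph s n, infix (factor x (- l%:Z) (l + l)) (sadic_word a)].

Definition generates (T : finType) (s : sadic T) (X : set (full_shift T)) : Prop :=
  sadic_subshift s = X.

Definition word_pow (A : Type) (v : seq A) (k : nat) : seq A :=
  flatten (nseq k v).

Definition is_root_length (T : eqType) (u : seq T) (m : nat) : bool :=
  `[< exists2 k : nat, (1 <= k)%N & u = word_pow (take m u) k >].

Lemma ex_root_length (T : eqType) (u : seq T) : exists m, is_root_length u m.
Proof.
by exists (size u); apply/asboolP; exists 1%N; rewrite // /word_pow /= cats0 take_size.
Qed.

(* Shortest prefix of which u is a power; root [::] = [::] is a junk value. *)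
Definition word_root (T : eqType) (u : seq T) : seq T :=
  take (ex_minn (ex_root_length u)) u.

Definition roots_of_level (T : finType) (s : sadic T) (n : nat) : {fset seq T} :=
  [fset word_root (sadic_word a) | a : sadic_alph s n]%fset.

(* Main.v *)
From mathcomp Require Import all_boot all_order all_algebra finmap.
From mathcomp Require Import all_classical all_reals all_analysis.
From mathcomp Require Import zify.
Require Import Defs.

(** Small complexity along a sequence of lengths comes down to being made, at
infinitely many scales, of blocks of comparable lengths that are powers of boundedly
many words.

One direction is a count. If the words of a level have lengths between [m] and [D m],
a factor of length [m] lies in the concatenation of two of them. A word is determined
by its root and its length, so the factor is determined by two roots and by its
distance to the boundary between the two words ([few_windows]). Boundedly many roots
leave [O(m)] factors, and [m] is unbounded because the subshift contains arbitrarily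
long factors ([sadic_slow]).

For the converse, fix a point and restrict it to a half-line [x], which has all the
factors of [X] because a minimal subshift is uniformly recurrent
([minimal_recurrent]). It is enough to find finite sets [W 0, W 1, ...] of factors,
with growing lengths, bounded length ratios and boundedly many roots, such that
the words of [W n.+1] are concatenations of words of [W n]: they can serve as the
alphabets of a directive sequence ([sadic_of_tower]), which generates [X] because long
factors contain all short ones ([tower_generates]). If [x] is periodic, powers of a
period do. Otherwise the sets are found one after the other, as follows.

Take [m] large with at most [K m] factors of length [m], put [tau = m / 16], and
choose [n] between [2 tau] and [4 tau] such that there are at most [16 K] more
factors of length [n.+1] than of length [n]. Among the extensions of a word of length
[n], at most one has a period [<= tau]; taking it as the default one, only boundedly
many windows of length [n.+1] are not default extensions. From these one gets a
bounded set of windows without short period, the markers, such that away from the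
markers [x] is locally periodic with short periods ([markers]). Two occurrences of a
marker are more than [tau] apart. So in a factor of length [m] at most one stretch of
length [15 tau] around a given marker begins in the first [tau] places. Since every
stretch occurs at each of these places in some factor of length [m], there are
boundedly many stretches ([windows]).

Now cut [x] at markers that are at least [tau] apart. A piece of length at most [8
tau] is seen in the stretch around its first marker, where markers have boundedly
many places, so there are boundedly many such pieces. A longer one contains a
periodic run. It is cut into a beginning, an end and, in between, powers of the
period of the run; the beginning and the end are again seen around markers, and so
is the period ([parsed_gap]). The number of different powers is not bounded, but the
number of their roots is.

The pieces must also be concatenations of words of the previous level. That level
provides a word [z] such that the factors of [x] between occurrences of [z] can be cut
into its words ([cuts_between]). So each cut is moved to a nearby occurrence of [z],
chosen as a function of the window of length [n.+1] at the cut. This changes pieces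
only through data that are already counted. A marker plays the role of [z] for the
new level ([next_level]). *)

Set Implicit Arguments.
Unset Strict Implicit.
Unset Printing Implicit Defensive.

(** * Powers and primitive roots of words *)

Lemma word_powS (A : Type) (v : seq A) k : word_pow v k.+1 = v ++ word_pow v k.
Proof. by []. Qed.

Lemma word_powD (A : Type) (v : seq A) j k :
  word_pow v (j + k) = word_pow v j ++ word_pow v k.
Proof. by rewrite /word_pow nseqD flatten_cat. Qed.

Lemma word_powM (A : Type) (v : seq A) j k :
  word_pow (word_pow v j) k = word_pow v (j * k).
Proof.
elim: k => [|k IHk]; first by rewrite muln0.
by rewrite word_powS IHk mulnS word_powD.
Qed.

Lemma size_word_pow (A : Type) (v : seq A) k : size (word_pow v k) = k * size v.
Proof. by rewrite /word_pow size_flatten /shape map_nseq sumn_nseq mulnC. Qed.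

Lemma nth_word_pow (A : Type) (x0 : A) v k i : i < k * size v ->
  nth x0 (word_pow v k) i = nth x0 v (i %% size v).
Proof.
elim: k i => [|k IHk] i lti; first by rewrite mul0n in lti.
rewrite word_powS nth_cat; case: ltnP => [lt_iv|le_vi]; first by rewrite modn_small.
rewrite mulSn in lti; rewrite IHk; last lia.
by rewrite -[in RHS](subnK le_vi) modnDr.
Qed.

(** Bezout coefficients with natural numbers suffice: [u a = v b + gcd], so adding
[gcd] and then [v b] amounts to adding a multiple of [a]. *)
Lemma periodic_gcdn (A : Type) (f : nat -> A) a b : 0 < a ->
  (forall i, f (i + a) = f i) -> (forall i, f (i + b) = f i) ->
  forall i, f (i + gcdn a b) = f i.
Proof.
move=> a_gt0 fa fb i.
have mul p : (forall i, f (i + p) = f i) -> forall k i, f (i + k * p) = f i.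
  by move=> fp; elim=> [|k IHk] j; rewrite ?addn0 // mulSn addnA IHk.
case: (egcdnP b a_gt0) => u v def_g _.
by rewrite -(mul b fb v (i + _)) -addnA [gcdn a b + _]addnC -def_g mul.
Qed.

Lemma is_root_lengthP (T : eqType) (u : seq T) m :
  reflect (exists2 k, 1 <= k & u = word_pow (take m u) k) (is_root_length u m).
Proof. exact: asboolP. Qed.

Lemma word_rootP (T : eqType) (u : seq T) :
  exists2 k, 1 <= k & u = word_pow (word_root u) k.
Proof. by rewrite /word_root; case: ex_minnP => m /is_root_lengthP. Qed.

Lemma size_word_root_le (T : eqType) (u v : seq T) k :
  1 <= k -> u = word_pow v k -> size (word_root u) <= size v.
Proof.
move=> k_gt0 def_u; rewrite /word_root; case: ex_minnP => m _ min_m.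
rewrite size_take_min; apply: leq_trans (geq_minl _ _) _; apply: min_m.
apply/is_root_lengthP; exists k => //.
have: take (size v) u = v by rewrite def_u -(prednK k_gt0) word_powS take_size_cat.
by move=> ->.
Qed.

Lemma take_word_root (T : eqType) (u : seq T) :
  word_root u = take (size (word_root u)) u.
Proof.
by rewrite {1 2}/word_root size_take_min take_min take_size.
Qed.

(** The words [u] and [s = word_root (u ^ j)] give two periods of the sequence
[u u u ...], so the gcd of their lengths is a period too. Both words are then powers
of its prefix of that length, and [s] has no shorter root than itself. *)
Lemma word_root_pow (T : eqType) (u : seq T) j :
  1 <= j -> word_root (word_pow u j) = word_root u.
Proof.
move=> j_gt0; have [u_nil|] := posnP (size u).
  by rewrite (size0nil u_nil) /word_pow (_ : flatten _ = [::]) //; elim: (j).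
case def_u: u => [//|x0 u']; rewrite -{u'}def_u => u_gt0.
set w := word_pow u j; have [k k_gt0 def_w] := word_rootP w.
set s := word_root w in def_w *.
have sz_w : j * size u = k * size s by rewrite -!size_word_pow -def_w.
have s_gt0 : 0 < size s by move: sz_w j_gt0 u_gt0; case: (size s) => //; nia.
pose f i := nth x0 u (i %% size u).
have fs i : f i = nth x0 s (i %% size s).
  have lt_i : i %% (j * size u) < j * size u by rewrite ltn_mod; nia.
  rewrite /f -(modn_dvdm i (dvdn_mull j (dvdnn (size u)))) -(nth_word_pow _ lt_i).
  rewrite -/w def_w nth_word_pow -?sz_w // modn_dvdm // sz_w.
  exact: dvdn_mull.
have fg := @periodic_gcdn _ f (size u) (size s) u_gt0 _ _.
set g := gcdn (size u) (size s) in fg.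
have {}fg i : f (i + g) = f i.
  by apply: fg => {}i; [rewrite /f modnDr | rewrite !fs modnDr].
have g_gt0 : 0 < g by rewrite gcdn_gt0 u_gt0.
have fgk k' i : f (i + k' * g) = f i.
  by elim: k' i => [|k' IH] i; rewrite ?addn0 // mulSn addnA IH fg.
have fmod i : f i = f (i %% g) by rewrite [in LHS](divn_eq i g) addnC fgk.
have power v : g %| size v -> 0 < size v -> (forall i, i < size v -> nth x0 v i = f i) ->
    v = word_pow (take g v) (size v %/ g).
  move=> gv v_gt0 vf; have le_gv : g <= size v by apply: dvdn_leq.
  have sz : size (take g v) = g by rewrite size_take_min; apply/minn_idPl.
  apply: (@eq_from_nth _ x0) => [|i lt_iv].
    by rewrite size_word_pow sz divnK.
  rewrite nth_word_pow sz ?divnK // nth_take ?ltn_mod // !vf // ?(leq_trans _ le_gv) ?ltn_mod //.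
have sz_s : size s = g.
  have s_pow : s = word_pow (take g s) (size s %/ g).
    apply: power; rewrite ?dvdn_gcdr // => i lt_is.
    by rewrite fs modn_small.
  have le_gs : g <= size s by apply: dvdn_leq => //; apply: dvdn_gcdr.
  have szt : size (take g s) = g by rewrite size_take_min; apply/minn_idPl.
  apply/eqP; rewrite eqn_leq le_gs andbT -[leqRHS]szt.
  apply: (@size_word_root_le _ w _ (size s %/ g * k)).
    by rewrite muln_gt0 divn_gt0 // le_gs.
  by rewrite -word_powM -s_pow.
have u_pow : u = word_pow (take g u) (size u %/ g).
  apply: power; rewrite ?dvdn_gcdl // => i lt_iu.
  by rewrite /f modn_small.
have le_gu : g <= size u by apply: dvdn_leq => //; apply: dvdn_gcdl.
have s_take : s = take g u.
  have:= take_word_root w; rewrite -/s sz_s => {1}->.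
  by rewrite /w -(prednK j_gt0) word_powS takel_cat.
have le_us : size (word_root u) <= size s.
  rewrite s_take; apply: (size_word_root_le _ u_pow).
  by rewrite divn_gt0 // le_gu.
have le_su : size s <= size (word_root u).
  have [k' k'_gt0 def_u'] := word_rootP u.
  apply: (@size_word_root_le _ w _ (k' * j)); first by rewrite muln_gt0 k'_gt0.
  by rewrite -word_powM -def_u'.
rewrite s_take take_word_root; congr (take _ u).
by rewrite -sz_s; apply/eqP; rewrite eqn_leq le_su.
Qed.

(** * Counting by codes *)

Lemma leq_size_inj_rel (A B : eqType) (r : A -> B -> Prop) (s : seq A) (s' : seq B) :
    uniq s -> (forall a, a \in s -> exists2 b, b \in s' & r a b) ->
    (forall a a' b, a \in s -> a' \in s -> r a b -> r a' b -> a = a') ->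
  size s <= size s'.
Proof.
move=> us ex_r inj_r.
case: s us ex_r inj_r => [//|a0 s] us ex_r inj_r.
have [h hP] : exists h, forall a, a \in a0 :: s -> h a \in s' /\ r a (h a).
  have [b0 _ _] := ex_r a0 (mem_head _ _).
  suff /choice[h hP] : forall a, exists b, a \in a0 :: s -> b \in s' /\ r a b by exists h.
  move=> a; have [a_s|] := boolP (a \in a0 :: s); last by exists b0.
  by have [b] := ex_r a a_s; exists b.
rewrite -(size_map h); apply: uniq_leq_size => [|_ /mapP[a /hP[? _] ->] //].
rewrite map_inj_in_uniq // => a a' a_s a'_s eq_h.
by apply: (inj_r a a' (h a)) => //; [case: (hP a a_s) | rewrite eq_h; case: (hP a' a'_s)].
Qed.

(** This is how roots are counted: the pieces of a decomposition are coded by data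
that determine their roots, even though they need not determine the pieces. *)
Lemma cover_by_codes (A : Type) (C B : eqType) (P : A -> Prop) (code : A -> C)
    (f : A -> B) (s : seq C) :
    (forall a, P a -> code a \in s) ->
    (forall a a', P a -> P a' -> code a = code a' -> f a = f a') ->
  exists2 r : seq B, size r <= size s & forall a, P a -> f a \in r.
Proof.
move=> code_s f_code.
have [g gP] : exists g : C -> option B,
    forall c, (forall a, P a -> code a = c -> g c = Some (f a)).
  suff /choice[g gP] : forall c, exists o : option B,
      forall a, P a -> code a = c -> o = Some (f a) by exists g.
  move=> c; have [[a [Pa def_c]]|no_a] := pselect (exists a, P a /\ code a = c).
    by exists (Some (f a)) => a' Pa' def_c'; rewrite (f_code a' a) ?def_c.
  by exists None => a Pa def_c; case: no_a; exists a.
exists (pmap g s); first by rewrite size_pmap count_size.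
move=> a Pa; rewrite mem_pmap; apply/mapP; exists (code a); first exact: code_s.
by rewrite (gP _ a).
Qed.

Lemma pigeonhole_seq (B : eqType) (f : nat -> B) (s : seq B) :
    (forall t, t <= size s -> f t \in s) ->
  exists t1 t2, [/\ t1 < t2, t2 <= size s & f t1 = f t2].
Proof.
move=> fs; apply: contrapT => noP.
suff: size (map f (iota 0 (size s).+1)) <= size s by rewrite size_map size_iota ltnn.
apply: uniq_leq_size; last first.
  by move=> _ /mapP[t t_s ->]; apply: fs; move: t_s; rewrite mem_iota; lia.
rewrite map_inj_in_uniq ?iota_uniq // => t1 t2; rewrite !mem_iota /= !add0n !ltnS.
move=> le1 le2 eq12; case: (ltngtP t1 t2) => // lt12; case: noP.
  by exists t1, t2.
by exists t2, t1.
Qed.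

(** * Factors of a one-sided sequence *)

Section Factors.
Variables (T : finType) (x : nat -> T).

(** The points of a subshift are studied on a half-line, where positions are natural
numbers; recurrence makes the half-line carry all factors of the subshift. *)
Definition fac i n : seq T := mkseq (fun k => x (i + k)) n.

Lemma size_fac i n : size (fac i n) = n. Proof. exact: size_mkseq. Qed.

Lemma eq_facP i j n : fac i n = fac j n <-> forall k, k < n -> x (i + k) = x (j + k).
Proof.
split=> [eq_f k lt_kn | eq_x]; last first.
  by apply/eq_in_map => k; rewrite mem_iota add0n; apply: eq_x.
by have:= congr1 (fun s => nth (x 0) s k) eq_f; rewrite !nth_mkseq.
Qed.

Lemma eq_sub_fac i j n a b :
  fac i n = fac j n -> a + b <= n -> fac (i + a) b = fac (j + a) b.
Proof.
move=> /eq_facP eq_x le_n; apply/eq_facP => k lt_kb.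
by rewrite -!addnA eq_x //; lia.
Qed.

Lemma facD i a b : fac i (a + b) = fac i a ++ fac (i + a) b.
Proof.
rewrite /fac /mkseq iotaD map_cat; congr (_ ++ _).
by rewrite add0n -[in LHS](addn0 a) iotaDl -map_comp; apply: eq_map => k /=; rewrite addnA.
Qed.

Lemma take_fac k i n : k <= n -> take k (fac i n) = fac i k.
Proof. by move=> le_kn; rewrite -(subnKC le_kn) facD take_size_cat ?size_fac. Qed.

Lemma drop_fac k i n : drop k (fac i n) = fac (i + k) (n - k).
Proof.
have [le_kn|lt_nk] := leqP k n; last first.
  by rewrite drop_oversize ?size_fac ?(ltnW lt_nk) // (eqP (ltnW lt_nk)).
by rewrite -{1}(subnKC le_kn) facD drop_size_cat ?size_fac.
Qed.

Definition facs n : seq (seq T) :=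
  [seq val w | w <- enum [pred w : n.-tuple T | `[< exists i, fac i n = w >]]].

Lemma facs_uniq n : uniq (facs n).
Proof. by rewrite map_inj_uniq ?enum_uniq //; apply: val_inj. Qed.

Lemma facsP n w : reflect (exists i, w = fac i n) (w \in facs n).
Proof.
apply: (iffP mapP) => [[u] | [i def_w]].
  by rewrite mem_enum => /asboolP[i def_u] ->; exists i.
have sz_w : size w == n by rewrite def_w size_fac.
exists (Tuple sz_w) => //; rewrite mem_enum; apply/asboolP.
by exists i.
Qed.

Lemma mem_facs i n : fac i n \in facs n. Proof. by apply/facsP; exists i. Qed.

Definition unif_recurrent := forall i n, exists g, forall j,
  exists2 k, k < g & fac (j + k) n = fac i n.

Definition ultimately_periodic := exists c, 0 < c /\
  exists t, forall i, t <= i -> x (i + c) = x i.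

(** * Periods of words *)

Definition has_period q (w : seq T) := drop q w == take (size w - q) w.

Lemma has_period_fac q i n :
  has_period q (fac i n) <-> forall k, k + q < n -> x (i + k + q) = x (i + k).
Proof.
rewrite /has_period size_fac drop_fac take_fac ?leq_subr //; split.
  move=> /eqP/eq_facP eq_x k lt_n; rewrite -eq_x; last lia.
  by congr x; lia.
move=> eq_x; apply/eqP/eq_facP => k lt_k; rewrite -eq_x; last lia.
by congr x; lia.
Qed.

Lemma has_period_overlap i d n : fac i n = fac (i + d) n -> has_period d (fac i n).
Proof.
move=> /eq_facP eq_x; apply/has_period_fac => k lt_n; rewrite eq_x; last lia.
by congr x; lia.
Qed.

Variable tau : nat.

Definition short_period (w : seq T) := has (has_period^~ w) (iota 1 tau).

Lemma short_periodP w : reflect (exists2 q, 0 < q <= tau & has_period q w) (short_period w).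
Proof.
apply: (iffP hasP) => [[q] | [q lt_q per_q]].
  by rewrite mem_iota => ? ?; exists q => //; lia.
by exists q => //; rewrite mem_iota; lia.
Qed.

Lemma eq_marker_dist N i j :
  ~~ short_period (fac i N) -> fac i N = fac j N -> i < j -> i + tau < j.
Proof.
move=> nsh eq_ij lt_ij; rewrite ltnNge; apply: contra nsh => le_j.
apply/short_periodP; exists (j - i); first lia.
by apply: has_period_overlap; rewrite subnKC // ltnW.
Qed.

Variable n : nat.
Hypotheses (tau_gt0 : 0 < tau) (tau_n : tau.*2 <= n).

Local Notation edge i := (fac i n.+1).

(** Two consecutive windows with periods [q, q' <= tau] overlap on [n >= q + q']
letters, which forces the first period to continue through the second window. *)
Lemma short_run a b q : 0 < q <= tau -> has_period q (edge a) -> a < b ->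
    (forall i, a <= i < b -> short_period (edge i)) ->
  forall i, a <= i -> i + q < b + n -> x (i + q) = x i.
Proof.
move=> q_tau per_q; elim: b => [//|b IHb] lt_ab sh i le_ai lt_i.
case: (ltngtP a b) => [{}lt_ab|lt_ba|eq_ab]; first 1 last.
- by move: lt_ab; lia.
- rewrite -[i](subnKC le_ai); move/has_period_fac: per_q; apply; lia.
have {}IHb: forall i, a <= i -> i + q < b + n -> x (i + q) = x i.
  by apply: IHb => // j /andP[? ?]; apply: sh; lia.
case: (ltnP (i + q) (b + n)) => [lt_iq|ge_iq].
  exact: IHb.
have /short_periodP[q' q'_tau /has_period_fac per_q'] : short_period (edge b) by apply: sh; lia.
have e1: x (i + q) = x (b + (n - q')) by rewrite -(per_q' (n - q')); [congr x|]; lia.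
have e2: x i = x (b + (n - q' - q)).
  by rewrite -(per_q' (n - q' - q)); [congr x|]; lia.
have e3: x (b + (n - q' - q) + q) = x (b + (n - q' - q)).
  by apply: IHb; lia.
by rewrite e1 e2 -e3; congr x; lia.
Qed.

(** Two right extensions of a word of length [n] with periods [p, p' <= tau] end in the
letters at [n - p] and [n - p'], and both equal the letter at [n - p - p'], since
[n >= 2 tau]. So at most one extension is periodic, and it may be taken as default. *)
Lemma default_extension : exists dft : seq T -> seq T, forall i,
  [/\ dft (fac i n) \in facs n.+1, take n (dft (fac i n)) = fac i n
    & short_period (edge i) -> dft (fac i n) = edge i].
Proof.
suff /choice[dft dftP] : forall v, exists e, forall i, v = fac i n ->
    [/\ e \in facs n.+1, take n e = v & short_period (edge i) -> e = edge i].
  by exists dft => i; apply: dftP.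
move=> v; have [[j [def_v sh]]|no_sh] :=
    pselect (exists j, v = fac j n /\ short_period (edge j)).
  exists (edge j) => i def_v'; rewrite mem_facs take_fac //; split=> // sh'.
  have [q q_tau /has_period_fac per_q] := short_periodP _ sh.
  have [q' q'_tau /has_period_fac per_q'] := short_periodP _ sh'.
  have /eq_facP eq_x : fac j n = fac i n by rewrite -def_v.
  apply/eq_facP => k; rewrite ltnS leq_eqVlt => /orP[/eqP->|]; last exact: eq_x.
  have e1: x (j + n) = x (j + (n - q)) by rewrite -(per_q (n - q)); [congr x|]; lia.
  have e2: x (i + n) = x (i + (n - q')) by rewrite -(per_q' (n - q')); [congr x|]; lia.
  have e3: x (i + (n - q)) = x (i + (n - q - q')).
    by rewrite -(per_q' (n - q - q')); [congr x|]; lia.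
  have e4: x (j + (n - q')) = x (j + (n - q - q')).
    by rewrite -(per_q (n - q - q')); [congr x|]; lia.
  by rewrite e1 e2 eq_x ?e3 -?(eq_x (n - q')) ?e4 ?eq_x //; lia.
have [[j def_v]|no_v] := pselect (exists j, v = fac j n); last first.
  by exists [::] => i def_v; case: no_v; exists i.
exists (edge j) => i def_v'; rewrite mem_facs take_fac //; split=> // sh.
by case: no_sh; exists i.
Qed.

End Factors.

(** * Markers *)

Section Markers.
Variables (T : finType) (x : nat -> T) (tau n : nat).
Hypotheses (tau_gt0 : 0 < tau) (tau_n : tau.*2 <= n).
Hypothesis aperiodic : ~ ultimately_periodic x.

Local Notation edge i := (fac x i n.+1).

(** Each word of length [n] has one default extension, so the other extensions number
at most the growth of the complexity at [n]. *)
Lemma size_nondefault (dft : seq T -> seq T) :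
    (forall i, dft (fac x i n) \in facs x n.+1) ->
    (forall i, take n (dft (fac x i n)) = fac x i n) ->
  size [seq e <- facs x n.+1 | e != dft (take n e)] + size (facs x n)
    <= size (facs x n.+1).
Proof.
move=> dft_facs dftK; rewrite -[leqRHS](count_predC (fun e => e != dft (take n e))).
rewrite size_filter leq_add2l -size_filter -(size_map dft).
apply: uniq_leq_size.
  rewrite map_inj_in_uniq ?facs_uniq // => _ _ /facsP[i ->] /facsP[j ->] eq_d.
  by rewrite -dftK eq_d dftK.
move=> _ /mapP[_ /facsP[i ->] ->]; rewrite mem_filter dft_facs /= dftK.
by rewrite eqxx.
Qed.

Section Defaults.
Variable dft : seq T -> seq T.

Let nxt (e : seq T) := dft (behead e).

Lemma iter_default i t :
    (forall s, i < s <= i + t -> edge s = dft (fac x s n)) ->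
  iter t nxt (edge i) = edge (i + t).
Proof.
elim: t => [|t IHt] def; first by rewrite addn0.
rewrite iterS IHt => [|s lt_s]; last by apply: def; lia.
by rewrite addnS [RHS]def ?/nxt -?drop1 ?drop_fac ?addn1 ?subn1 //; lia.
Qed.

Lemma iter_period (e : seq T) t1 t2 : t1 < t2 -> iter t1 nxt e = iter t2 nxt e ->
  forall k t, t1 <= t -> iter (t + k * (t2 - t1)) nxt e = iter t nxt e.
Proof.
move=> lt12 eq12; elim=> [|k IHk] t le_t; first by rewrite addn0.
rewrite mulSn addnA IHk; last lia.
have -> : t + (t2 - t1) = (t - t1) + t2 by lia.
by rewrite iterD -eq12 -iterD subnK.
Qed.

(** If every extension from some point on were the default one, the windows would be
the orbit of a self-map of a finite set. *)
Lemma nondefault_infinite j : exists2 i, j <= i & edge i != dft (fac x i n).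
Proof.
apply: contrapT => noP; apply: aperiodic.
have def s : j <= s -> edge s = dft (fac x s n).
  by move=> le_js; apply: contrapT => /eqP ne; apply: noP; exists s.
have it t : iter t nxt (edge j) = edge (j + t).
  by apply: iter_default => s /andP[lt_s _]; apply: def; apply: ltnW.
have [|t1 [t2 [lt12 _ eq12]]] :=
  @pigeonhole_seq _ (fun t => edge (j + t)) (facs x n.+1).
  by move=> t _; apply: mem_facs.
rewrite -!it in eq12.
exists (t2 - t1); split; first lia.
exists (j + t1) => i le_i; have:= iter_period lt12 eq12 1 (t := i - j).
rewrite !it mul1n => /(_ _)/eq_facP/(_ 0 isT); rewrite !addn0 => eq_x.
have -> : i + (t2 - t1) = j + (i - j + (t2 - t1)) by lia.
by rewrite eq_x; [congr x|]; lia.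
Qed.

End Defaults.

(** The markers are the windows that end in a nondefault letter, together with,
along each of the default paths that they start, the first window without short
period in each of the successive time slices of length [tau]. A default path is
eventually cyclic, so its first [2 P + 2 tau] windows, where [P] is the number of
windows, show everything that can follow. *)
Lemma markers K D : size (facs x n.+1) <= size (facs x n) + K ->
    size (facs x n.+1) <= D * tau ->
  exists E : seq (seq T), exists j0,
  [/\ size E <= K * (D.*2 + 3), (forall e, e \in E -> ~~ short_period tau e),
      forall j, j0 <= j -> ~~ short_period tau (edge j) ->
        exists2 i, i <= j <= i + tau & edge i \in E
    & forall j, exists2 i, j <= i & edge i \in E].
Proof.
move=> leK leD; have [dft dftP] := default_extension x tau_gt0 tau_n.
have dft_facs i : dft (fac x i n) \in facs x n.+1 by case: (dftP i).
have dftK i : take n (dft (fac x i n)) = fac x i n by case: (dftP i).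
have dft_sh i : short_period tau (edge i) -> dft (fac x i n) = edge i by case: (dftP i).
pose E1 := [seq e <- facs x n.+1 | e != dft (take n e)].
have mem_E1 i : (edge i \in E1) = (edge i != dft (fac x i n)).
  by rewrite mem_filter mem_facs andbT take_fac.
have nsh_E1 e : e \in E1 -> ~~ short_period tau e.
  rewrite mem_filter => /andP[ne_e /facsP[i def_e]]; apply: contra ne_e.
  by rewrite def_e take_fac // => /dft_sh ->.
have sz_E1 : size E1 <= K.
  have := size_nondefault dft_facs dftK; rewrite -/E1; lia.
pose nxt (e : seq T) := dft (behead e); pose J := D.*2 + 2.
pose path (p : seq T * nat) := iter p.2 nxt p.1.
pose P2 (p : seq T * nat) := [/\ p.1 \in E1, p.2 < J * tau, ~~ short_period tau (path p)
  & forall t, t < p.2 -> t %/ tau = p.2 %/ tau -> short_period tau (path (p.1, t))].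
have [||E2 sz_E2 mem_E2] := @cover_by_codes _ _ _ P2 (fun p => (p.1, p.2 %/ tau))
    path (allpairs pair E1 (iota 0 J)).
- move=> [e t] [/= e_E1 lt_t _ _]; apply/allpairsP; exists (e, t %/ tau).
  by rewrite mem_iota ltn_divLR.
- move=> [e t] [e' t'] [/= _ _ nsh first] [/= _ _ nsh' first'] [eq_e eq_t].
  rewrite -{e'}eq_e in nsh' first' *.
  case: (ltngtP t t') => [lt_t|gt_t|-> //].
    by case/negP: nsh; apply: first'.
  by case/negP: nsh'; apply: first.
rewrite size_allpairs size_iota in sz_E2.
pose E := E1 ++ [seq e <- E2 | ~~ short_period tau e].
have [j0 _ j0_E1] := nondefault_infinite dft 0; rewrite -mem_E1 in j0_E1.
exists E, j0; split.
- rewrite size_cat size_filter (leq_trans (leq_add (leqnn _) (count_size _ _))) //.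
  apply: leq_trans (leq_add sz_E1 (leq_trans sz_E2 (leq_mul sz_E1 (leqnn J)))) _.
  by rewrite -mulnS /J -addnS.
- move=> e; rewrite mem_cat => /orP[/nsh_E1 //|].
  by rewrite mem_filter => /andP[].
- move=> j le_j nsh_j.
  pose isE1 i := (i <= j) && (edge i \in E1).
  have isE1_le i : isE1 i -> i <= j by case/andP.
  have exE1 : exists i, isE1 i by exists j0; apply/andP.
  have [i /andP[le_ij i_E1] max_i] := ex_maxnP exE1 isE1_le.
  have [t def_t] : exists t, j = i + t by exists (j - i); rewrite subnKC.
  have it s : s <= t -> iter s nxt (edge i) = edge (i + s).
    move=> le_s; apply: iter_default => r lt_r; apply/eqP.
    rewrite -[_ == _]negbK -mem_E1; apply/negP => r_E1.
    by have := max_i r; rewrite /isE1 r_E1; lia.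
  (* the first window without short period in the slice of a given one *)
  have slice s : s < J * tau -> ~~ short_period tau (iter s nxt (edge i)) ->
      exists2 r, r <= s < r + tau & iter r nxt (edge i) \in E.
    move=> lt_s nsh_s.
    pose Q r := (r %/ tau == s %/ tau) && ~~ short_period tau (iter r nxt (edge i)).
    have exQ : exists r, Q r by exists s; rewrite /Q eqxx.
    have [r /andP[/eqP eq_r nsh_r] min_r] := ex_minnP exQ.
    have le_rs : r <= s by apply: min_r; rewrite /Q eqxx.
    have lt_sr : s < r + tau.
      by rewrite (divn_eq s tau) (divn_eq r tau) eq_r; have := ltn_pmod s tau_gt0; lia.
    exists r; first by rewrite le_rs.
    rewrite mem_cat; apply/orP; right; rewrite mem_filter; apply/andP; split=> //.
    apply: (mem_E2 (edge i, r)); split=> //=; first lia.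
    move=> t' lt_t' eq_t'; apply: contraLR lt_t' => nsh_t'; rewrite -leqNgt.
    by apply: min_r; rewrite /Q eq_t' eq_r eqxx.
  have [lt_t|ge_t] := ltnP t (J * tau).
    have [|r lt_r r_E] := slice t lt_t; first by rewrite it // -def_t.
    by exists (i + r); [lia | rewrite -it //; lia].
  pose P := size (facs x n.+1).
  have PJ : P.*2 + tau < J * tau by rewrite /J /P; nia.
  have [|t1 [t2 [lt12 le2 eq12]]] :=
    @pigeonhole_seq _ (fun t => iter t nxt (edge i)) (facs x n.+1).
    by move=> s le_s; rewrite it ?mem_facs //; move: le_s; rewrite -/P; lia.
  have per := iter_period lt12 eq12.
  pose c := t2 - t1; have c_gt0 : 0 < c by rewrite subn_gt0.
  (* bring the time back to the range that the slices cover, but keep [t1 + tau]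
     below it, so that the slice preceding it lies in the cyclic part *)
  pose k := (t - (P + tau)) %/ c; pose s := t - k * c.
  have le_kc : k * c <= t - (P + tau) by apply: leq_trunc_div.
  have lt_kc : t - (P + tau) < k * c + c by have := ltn_ceil (t - (P + tau)) c_gt0; nia.
  have ts : t = s + k * c by rewrite /s; lia.
  have ps : P + tau <= s < P.*2 + tau by rewrite /s; move: le2; rewrite -/P; lia.
  have [||r lt_r r_E] := slice s; first lia.
    by rewrite -(per k) -?ts ?it // -?def_t //; move: le2; rewrite -/P; lia.
  exists (i + (r + k * c)); first lia.
  by rewrite -it; [rewrite per //|]; move: le2; rewrite -/P; lia.
- move=> j; have [i le_ji i_E1] := nondefault_infinite dft j.
  by exists i; rewrite // mem_cat mem_E1 i_E1.
Qed.

End Markers.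

(** * Cutting between markers *)

(** What a level of the tower hands over to the next one: between two occurrences of
the word [z], shifted by [d], the sequence can be cut into words of [W]. *)
Definition cuts_between (T : finType) (x : nat -> T) (W : seq (seq T)) (z : seq T)
    (d : nat) :=
  [/\ exists i, fac x i (size z) = z, d <= size z
    & forall i j, i < j -> fac x i (size z) = z -> fac x j (size z) = z ->
      exists2 ws, {subset ws <= W} & flatten ws = fac x (i + d) (j - i)].

Lemma shortest_period (T : finType) (tau : nat) : exists per : seq T -> nat,
  forall w, short_period tau w -> [/\ 0 < per w <= tau, has_period (per w) w
    & forall q, 0 < q < per w -> ~~ has_period q w].
Proof.
suff /choice[per perP] : forall w : seq T, exists p, short_period tau w ->
    [/\ 0 < p <= tau, has_period p w & forall q, 0 < q < p -> ~~ has_period q w].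
  by exists per.
move=> w; have [/short_periodP[q q_tau per_q]|_] := boolP (short_period tau w); last by exists 0.
have exP : exists q, (0 < q) && has_period q w by exists q; lia.
have [p /andP[p_gt0 per_p] min_p] := ex_minnP exP.
exists p => _; split=> //; first by have := min_p q; lia.
by move=> r r_p; apply/negP => per_r; have := min_p r; lia.
Qed.

Section Cutting.
Variables (T : finType) (x : nat -> T) (tau n : nat).
Hypotheses (tau_gt0 : 0 < tau) (tau_n : tau.*2 <= n) (n_tau : n < 4 * tau).

Local Notation edge i := (fac x i n.+1).

Variables (E : seq (seq T)) (j0 : nat).
Hypothesis E_long : forall e, e \in E -> ~~ short_period tau e.
Hypothesis E_dense : forall j, j0 <= j -> ~~ short_period tau (edge j) ->
  exists2 i, i <= j <= i + tau & edge i \in E.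

(** The bound [4 tau] leaves room on the left for the window around [c] (see below),
moved by up to [tau]. *)
Definition marked c := (4 * tau + j0 <= c) && (edge c \in E).

(** On the right, [12 tau] letters show the windows of all positions up to [8 tau]
away; on the left, [3 tau] letters show where the last piece of a run begins. *)
Definition window c := fac x (c - 3 * tau) (15 * tau).

Lemma marked_ge c : marked c -> 4 * tau + j0 <= c. Proof. by case/andP. Qed.

Lemma eq_window c c' p p' l : window c = window c' -> marked c -> marked c' ->
    p + c' = p' + c -> c <= p + 3 * tau -> p + l <= c + 12 * tau ->
  fac x p l = fac x p' l.
Proof.
move=> eq_w /marked_ge ge_c /marked_ge ge_c' eq_p le_cp le_pl.
have -> : p = c - 3 * tau + (p + 3 * tau - c) by lia.
have -> : p' = c' - 3 * tau + (p + 3 * tau - c) by lia.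
by apply: eq_sub_fac eq_w _; lia.
Qed.

Lemma marked_dist c c' : marked c -> edge c = edge c' -> c < c' -> c + tau < c'.
Proof. by case/andP=> _ /E_long; apply: eq_marker_dist. Qed.

(** A word of length [m >= 16 tau] that contains the window around a marker, starting
less than [tau] from its left end, determines that window as soon as the marker is
known: two candidate positions would give the marker a short period. So each window uses up
[tau] of the words of length [m]. *)
Lemma windows m : 16 * tau <= m -> exists Ws : seq (seq T),
  size Ws * tau <= size E * size (facs x m) /\ forall c, marked c -> window c \in Ws.
Proof.
move=> le_m.
pose Ws := [seq u <- facs x (15 * tau) | `[< exists2 c, marked c & u = window c >]].
exists Ws; split; last first.
  by move=> c mk_c; rewrite mem_filter mem_facs andbT; apply/asboolP; exists c.
rewrite -[tau in X in X <= _](size_iota 0) -!(size_allpairs pair).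
pose r (p q : seq T * _) := exists c, [/\ marked c, p.1 = window c, q.1 = edge c
  & q.2 = fac x (c - 3 * tau - p.2) m].
apply: (@leq_size_inj_rel _ _ r).
- by rewrite allpairs_uniq ?filter_uniq ?facs_uniq ?iota_uniq // => -[? ?] [? ?].
- move=> _ /allpairsP[[u o] [/= u_W _ ->]].
  move: u_W; rewrite mem_filter => /andP[/asboolP[c mk_c ->] _].
  exists (edge c, fac x (c - 3 * tau - o) m); last by exists c.
  by apply/allpairsP; exists (edge c, fac x (c - 3 * tau - o) m);
     rewrite mem_facs; case/andP: mk_c.
have le_o (u u' : seq T) o o' a w : o < tau -> o' < tau ->
    r (u, o) (a, w) -> r (u', o') (a, w) -> o' <= o.
  move=> lt_o lt_o' [c [/= mk_c _ eq_a eq_w]] [c' [/= mk_c' _ eq_a' eq_w']].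
  rewrite leqNgt; apply/negP => lt_oo'.
  have := marked_ge mk_c; have := marked_ge mk_c' => ge_c' ge_c.
  have eq_f : edge (c - 3 * tau - o + (3 * tau + o)) =
              edge (c' - 3 * tau - o' + (3 * tau + o)).
    by apply: (@eq_sub_fac _ x _ _ m); [rewrite -eq_w | lia].
  have def_c : c - 3 * tau - o + (3 * tau + o) = c by lia.
  rewrite {}def_c -eq_a eq_a' in eq_f.
  have := @eq_marker_dist _ x tau _ _ c' _ (esym eq_f).
  by rewrite -eq_f => /(_ (E_long _)); case/andP: mk_c' => _ -> /(_ isT); lia.
move=> _ _ [a w] /allpairsP[[u o] [/= _ o_tau ->]] /allpairsP[[u' o'] [/= _ o'_tau ->]].
rewrite !mem_iota /= !add0n in o_tau o'_tau.
move=> r1 r2; have eq_o : o = o'.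
  by apply/eqP; rewrite eqn_leq (le_o _ _ _ _ _ _ _ _ r1 r2) ?(le_o _ _ _ _ _ _ _ _ r2 r1).
rewrite -{o'}eq_o in r2 o'_tau *; congr (_, _).
case: r1 r2 => [c [/= /marked_ge ge_c -> _ eq_w]] [c' [/= /marked_ge ge_c' -> _ eq_w']].
have : fac x (c - 3 * tau - o + o) (15 * tau) = fac x (c' - 3 * tau - o + o) (15 * tau).
  by apply: (@eq_sub_fac _ x _ _ m); [rewrite -eq_w | lia].
by rewrite !subnK //; lia.
Qed.

Variables (W : seq (seq T)) (z : seq T) (d : nat) (g : nat).
Hypothesis W_cuts : cuts_between x W z d.
Hypothesis z_rec : forall j, exists2 k, k < g & fac x (j + k) (size z) = z.
Hypothesis z_tau : (g + size z).*2 <= tau.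

Lemma shift_exists : exists sh : seq T -> nat, forall i,
  (sh (edge i)).*2 + d.*2 <= tau /\ fac x (i + sh (edge i)) (size z) = z.
Proof.
suff /choice[sh shP] : forall e, exists k, forall i, e = edge i ->
    k.*2 + d.*2 <= tau /\ fac x (i + k) (size z) = z.
  by exists sh => i; apply: shP.
have [_ le_dz _] := W_cuts.
move=> e; have [[j def_e]|no_e] := pselect (exists j, e = edge j); last first.
  by exists 0 => i def_e; case: no_e; exists i.
have [k lt_kg def_z] := z_rec j; exists k => i def_e'; split; first lia.
rewrite -[RHS]def_z; apply: (@eq_sub_fac _ x _ _ n.+1); last lia.
by rewrite -def_e'.
Qed.

Variables (sh : seq T -> nat).
Hypothesis shP : forall i,
  (sh (edge i)).*2 + d.*2 <= tau /\ fac x (i + sh (edge i)) (size z) = z.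

(** A cut assigned to the position [c] is made at an occurrence of [z] that the window
at [c] determines, so that the pieces are concatenations of words of [W]. *)
Definition cut_pos c := c + sh (edge c) + d.
Definition piece a b := fac x (cut_pos a) (cut_pos b - cut_pos a).

Lemma cut_pos_ge c : c <= cut_pos c. Proof. by rewrite /cut_pos -addnA leq_addr. Qed.

Lemma cut_pos_le c : (cut_pos c).*2 <= c.*2 + tau.
Proof. by have [] := shP c; rewrite /cut_pos; lia. Qed.

Lemma piece_cuts a b : a + tau <= b ->
  exists2 ws, {subset ws <= W} & flatten ws = piece a b.
Proof.
move=> le_ab; have [_ _ cutW] := W_cuts.
have [le_a za] := shP a; have [le_b zb] := shP b.
have [|ws ws_W def_ws] := cutW _ _ _ za zb; first lia.
by exists ws => //; rewrite def_ws /piece /cut_pos; congr fac; lia.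
Qed.

Lemma piece_cat a b c : a + tau <= b -> b + tau <= c ->
  piece a c = piece a b ++ piece b c.
Proof.
move=> le_ab le_bc; have := (cut_pos_ge a, cut_pos_ge b, cut_pos_ge c).
have := (cut_pos_le a, cut_pos_le b, cut_pos_le c) => -[[? ?] ?] [[? ?] ?].
rewrite /piece.
have -> : fac x (cut_pos b) = fac x (cut_pos a + (cut_pos b - cut_pos a)).
  by rewrite subnKC //; lia.
by rewrite -facD; congr fac; lia.
Qed.

Lemma eq_piece a b a' b' : edge a = edge a' -> edge b = edge b' ->
    a + b' = a' + b -> fac x a (cut_pos b - a) = fac x a' (cut_pos b' - a') ->
  piece a b = piece a' b'.
Proof.
move=> eq_a eq_b eq_ab eq_f.
have eq_pa : cut_pos a - a = cut_pos a' - a' by rewrite /cut_pos eq_a; lia.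
have eq_pb : cut_pos b - a = cut_pos b' - a' by rewrite /cut_pos eq_b; lia.
have := congr1 (drop (cut_pos a - a)) eq_f; rewrite {2}eq_pa !drop_fac.
rewrite !subnKC ?cut_pos_ge // /piece => eq_d.
have := (cut_pos_ge a, cut_pos_ge a') => -[? ?].
have -> : cut_pos b - cut_pos a = cut_pos b - a - (cut_pos a - a) by lia.
by have -> : cut_pos b' - cut_pos a' = cut_pos b' - a' - (cut_pos a' - a') by lia.
Qed.


Variables (Ws : seq (seq T)) (per : seq T -> nat).
Hypothesis Ws_win : forall c, marked c -> window c \in Ws.
Hypothesis perP : forall w, short_period tau w -> [/\ 0 < per w <= tau, has_period (per w) w
  & forall q, 0 < q < per w -> ~~ has_period q w].

Lemma eq_window_edge c c' o : window c = window c' -> marked c -> marked c' -> o <= 8 * tau ->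
  edge (c + o) = edge (c' + o).
Proof. by move=> eq_w mk_c mk_c' le_o; apply: (eq_window eq_w) => //; lia. Qed.

Lemma eq_window_piece c c' o o' : window c = window c' -> marked c -> marked c' ->
  o <= o' <= 8 * tau -> piece (c + o) (c + o') = piece (c' + o) (c' + o').
Proof.
move=> eq_w mk_c mk_c' le_oo'.
have eq_o' : edge (c + o') = edge (c' + o') by apply: eq_window_edge => //; lia.
apply: eq_piece; [by apply: eq_window_edge => //; lia | by [] | lia |].
have -> : cut_pos (c' + o') - (c' + o) = cut_pos (c + o') - (c + o) by rewrite /cut_pos eq_o'; lia.
by have := cut_pos_le (c + o'); have := cut_pos_ge (c + o') => ? ?; apply: (eq_window eq_w) => //; lia.
Qed.

(** Occurrences of the marker [edge c'] are more than [tau] apart, so the quotient of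
[c' - c] by [tau] tells which of them, to the right of [c], is meant. *)
Lemma roots_between_markers : exists2 R : seq (seq T),
  size R <= size Ws * size E * 9 & forall c c', marked c -> marked c' ->
  c + tau <= c' <= c + 8 * tau -> word_root (piece c c') \in R.
Proof.
pose P p := [/\ marked p.1, marked p.2 & p.1 + tau <= p.2 <= p.1 + 8 * tau].
pose code p := (window p.1, edge p.2, (p.2 - p.1) %/ tau).
have [||R sz_R mem_R] := @cover_by_codes _ _ _ P code
    (fun p => word_root (piece p.1 p.2)) (allpairs pair (allpairs pair Ws E) (iota 0 9)).
- move=> [c c'] [mk_c mk_c' le_c]; rewrite /fst /snd in mk_c mk_c' le_c.
  apply: (allpairs_f pair).
    by apply: (allpairs_f pair); [apply: Ws_win | case/andP: mk_c'].
  by rewrite mem_iota ltn_divLR /=; lia.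
- have le_dist c1 c1' c2 c2' : P (c1, c1') -> P (c2, c2') ->
      code (c1, c1') = code (c2, c2') -> c2' - c2 <= c1' - c1.
    move=> [/= mk1 mk1' le1] [/= mk2 mk2' le2] eq_c.
    have eq_w : window c1 = window c2 := congr1 (fun p => p.1.1) eq_c.
    have eq_e : edge c1' = edge c2' := congr1 (fun p => p.1.2) eq_c.
    have eq_q : (c1' - c1) %/ tau = (c2' - c2) %/ tau := congr1 snd eq_c.
    rewrite leqNgt; apply/negP => lt_d.
    have eq_e' : edge (c2 + (c1' - c1)) = edge (c1 + (c1' - c1)).
      by apply: eq_window_edge => //; lia.
    have lt_c : c2 + (c1' - c1) < c2' by lia.
    have := @eq_marker_dist _ x tau n.+1 _ _ _ _ lt_c.
    rewrite eq_e' subnKC -?eq_e; last lia.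
    case/andP: mk1' => _ /E_long nsh /(_ nsh erefl).
    rewrite (divn_eq (c1' - c1) tau) eq_q => lt_c2.
    have := divn_eq (c2' - c2) tau; have := ltn_pmod (c2' - c2) tau_gt0; lia.
  move=> [c1 c1'] [c2 c2'] P1 P2 eq_c.
  have le12 := le_dist _ _ _ _ P1 P2 eq_c.
  have le21 := le_dist _ _ _ _ P2 P1 (esym eq_c).
  have eq_w : window c1 = window c2 := congr1 (fun p => p.1.1) eq_c.
  case: P1 P2 => [/= mk1 mk1' le1] [/= mk2 mk2' le2].
  have eq_p := eq_window_piece (o := 0) (o' := c1' - c1) eq_w mk1 mk2 _.
  congr word_root; rewrite !addn0 in eq_p.
  have d1 : c1 + (c1' - c1) = c1' by lia.
  have d2 : c2 + (c1' - c1) = c2' by lia.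
  by rewrite -d1 -[in RHS]d2; apply: eq_p; lia.
exists R; last by move=> c c' mk_c mk_c' le_c; apply: (mem_R (c, c')).
by rewrite !size_allpairs size_iota in sz_R.
Qed.

Lemma roots_after_markers : exists2 R : seq (seq T),
  size R <= size Ws & forall c, marked c -> word_root (piece c (c + 2 * tau)) \in R.
Proof.
apply: (@cover_by_codes _ _ _ marked window) => // c c' mk_c mk_c' eq_w; congr word_root.
have := eq_window_piece (o := 0) (o' := 2 * tau) eq_w mk_c mk_c' _.
by rewrite !addn0; apply; lia.
Qed.

Definition run_period c := per (edge (c + 2 * tau)).

Lemma roots_in_runs : exists2 R : seq (seq T),
  size R <= size Ws & forall c, marked c /\ short_period tau (edge (c + 2 * tau)) ->
    word_root (fac x (cut_pos (c + 2 * tau)) (run_period c)) \in R.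
Proof.
apply: (@cover_by_codes _ _ _ _ window) => [c [mk_c _]|c c' [mk_c sh_c] [mk_c' _] eq_w].
  exact: Ws_win.
have eq_v : edge (c + 2 * tau) = edge (c' + 2 * tau) by apply: eq_window_edge => //; lia.
congr word_root; rewrite /run_period -eq_v.
have [le_per _ _] := perP sh_c.
have := cut_pos_le (c + 2 * tau); have := cut_pos_ge (c + 2 * tau) => ? ?.
by apply: (eq_window eq_w) => //; [rewrite /cut_pos -eq_v | |]; lia.
Qed.

(** The last piece of a run goes from an occurrence of the window [v] that begins the
run to the marker [c'] that follows the run. Its length is known up to a multiple of
the shortest period of [v], and the occurrences of [v] before [c'] are seen in the
window at [c']. *)
Lemma roots_after_runs : exists2 R : seq (seq T),
  size R <= size Ws * size Ws & forall c c' b, marked c -> marked c' ->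
    short_period tau (edge (c + 2 * tau)) -> edge b = edge (c + 2 * tau) ->
    b + 2 * tau <= c' < b + 2 * tau + run_period c ->
  word_root (piece b c') \in R.
Proof.
pose P p := let: (c, c', b) := p in [/\ marked c, marked c', short_period tau (edge (c + 2 * tau)),
  edge b = edge (c + 2 * tau) & b + 2 * tau <= c' < b + 2 * tau + run_period c].
pose code (p : nat * nat * nat) := (window p.1.1, window p.1.2).
have [||R sz_R mem_R] := @cover_by_codes _ _ _ P code
    (fun p => word_root (piece p.2 p.1.2)) (allpairs pair Ws Ws).
- move=> [[c c'] b] [/= mk_c mk_c' _ _ _].
  by apply: (allpairs_f pair); apply: Ws_win.
- have le_dist c1 c1' b1 c2 c2' b2 : P (c1, c1', b1) -> P (c2, c2', b2) ->
      code (c1, c1', b1) = code (c2, c2', b2) -> c2' - b2 <= c1' - b1.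
    move=> [/= mk1 mk1' sh1 eq_b1 le1] [/= mk2 mk2' sh2 eq_b2 le2] eq_c.
    have eq_w : window c1 = window c2 := congr1 fst eq_c.
    have eq_w' : window c1' = window c2' := congr1 snd eq_c.
    have eq_v : edge (c1 + 2 * tau) = edge (c2 + 2 * tau) by apply: eq_window_edge => //; lia.
    have [per1 _ min_per] := perP sh1.
    rewrite /run_period -eq_v -/(run_period c1) in le2.
    rewrite -/(run_period c1) in per1 min_per.
    rewrite leqNgt; apply/negP => lt_d.
    have := marked_ge mk1'; have := marked_ge mk2' => ge2 ge1.
    have eq_e : edge b2 = edge (c1' - (c2' - b2)).
      by apply: (eq_window (esym eq_w')) => //; lia.
    have eq_i : edge (c1' - (c2' - b2)) =
                edge (c1' - (c2' - b2) + (c2' - b2 - (c1' - b1))).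
      have -> : c1' - (c2' - b2) + (c2' - b2 - (c1' - b1)) = b1 by lia.
      by rewrite -eq_e eq_b1 eq_b2.
    have := has_period_overlap eq_i; rewrite -eq_e eq_b2 -eq_v.
    by apply/negP/min_per; lia.
  move=> [[c1 c1'] b1] [[c2 c2'] b2] P1 P2 eq_c.
  have le12 := le_dist _ _ _ _ _ _ P1 P2 eq_c.
  have le21 := le_dist _ _ _ _ _ _ P2 P1 (esym eq_c).
  have eq_w : window c1 = window c2 := congr1 fst eq_c.
  have eq_w' : window c1' = window c2' := congr1 snd eq_c.
  case: P1 P2 => [/= mk1 mk1' sh1 eq_b1 le1] [/= mk2 mk2' sh2 eq_b2 le2].
  have eq_v : edge (c1 + 2 * tau) = edge (c2 + 2 * tau) by apply: eq_window_edge => //; lia.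
  have [per1 _ _] := perP sh1.
  rewrite /run_period -eq_v -/(run_period c1) in le2; rewrite -/(run_period c1) in per1.
  have eq_e' : edge c1' = edge c2'.
    by rewrite -[c1']addn0 -[c2']addn0; apply: eq_window_edge.
  congr word_root; apply: eq_piece => //; [by rewrite eq_b1 eq_b2 | lia |].
  have -> : cut_pos c2' - b2 = cut_pos c1' - b1 by rewrite /cut_pos eq_e'; lia.
  by have := cut_pos_le c1'; have := cut_pos_ge c1' => ? ?; apply: (eq_window eq_w') => //; lia.
exists R; last by move=> c c' b *; apply: (mem_R (c, c', b)).
by rewrite size_allpairs in sz_R.
Qed.

Definition good_word (R : seq (seq T)) w := [/\ w \in facs x (size w),
  tau <= 2 * size w <= 17 * tau, word_root w \in R
  & exists2 ws, {subset ws <= W} & flatten ws = w].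

Definition parsed R a b := exists2 ws, {in ws, forall w, good_word R w} & flatten ws = piece a b.

Lemma parsed1 R a b : a + tau <= b <= a + 8 * tau -> word_root (piece a b) \in R ->
  parsed R a b.
Proof.
move=> /andP[le_ab le_ba] root_R; exists [:: piece a b]; last exact: cats0.
move=> _ /[1!inE] /eqP ->; split=> //; last exact: piece_cuts.
- by rewrite /piece size_fac mem_facs.
- rewrite /piece size_fac; have := (cut_pos_le a, cut_pos_le b) => -[? ?].
  by have := (cut_pos_ge a, cut_pos_ge b) => -[? ?]; lia.
Qed.

Lemma parsed_cat R a b c : a + tau <= b -> b + tau <= c ->
  parsed R a b -> parsed R b c -> parsed R a c.
Proof.
move=> le_ab le_bc [ws good_ws def_ws] [ws' good_ws' def_ws'].
exists (ws ++ ws'); last by rewrite flatten_cat def_ws def_ws' -piece_cat.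
by move=> w; rewrite mem_cat => /orP[/good_ws | /good_ws'].
Qed.

Section Run.
Variables (c c1 : nat).
Let b := c + 2 * tau.
Hypotheses (lt_b : b < c1) (sh_run : forall i, b <= i < c1 -> short_period tau (edge i)).
Let q := run_period c.

Let sh_b : short_period tau (edge b). Proof. by apply: sh_run; rewrite leqnn lt_b. Qed.

Lemma run_period_le : 0 < q <= tau. Proof. by have [] := perP sh_b. Qed.

Lemma edge_run k : b + k * q < c1 -> edge (b + k * q) = edge b.
Proof.
elim: k => [|k IHk] lt_k; first by rewrite addn0.
have q_tau := run_period_le.
rewrite -IHk; last by move: lt_k; rewrite mulSn; lia.
have [_ per_q _] := perP sh_b.
have run := short_run tau_gt0 tau_n q_tau per_q lt_b sh_run.
apply/eq_facP => t lt_t; rewrite mulSn.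
have -> : b + (q + k * q) + t = b + k * q + t + q by lia.
by apply: run; move: lt_k; rewrite ?mulSn; lia.
Qed.

Lemma fac_run j k : b + (j + k) * q < c1 ->
  fac x (cut_pos (b + j * q)) (k * q) = word_pow (fac x (cut_pos b) q) k.
Proof.
have q_tau := run_period_le; elim: k j => [//|k IHk] j lt_jk.
have e_j : edge (b + j * q) = edge b by apply: edge_run; nia.
have def_pos i : edge (b + i * q) = edge b -> cut_pos (b + i * q) = cut_pos b + i * q.
  by rewrite /cut_pos => ->; lia.
rewrite mulSn facD word_powS; congr (_ ++ _).
  have := cut_pos_le b; have := cut_pos_ge b => ge_p le_p.
  have -> : cut_pos (b + j * q) = b + j * q + (cut_pos b - b) by rewrite def_pos //; lia.
  rewrite -[in RHS](subnKC ge_p).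
  by apply: (eq_sub_fac e_j); lia.
rewrite -(IHk j.+1) ?addSnnS // !def_pos //; last by apply: edge_run; nia.
by congr fac; rewrite mulSn; lia.
Qed.

(** The pieces are powers of a conjugate of the period. When more than [4 tau] letters
remain, a piece of length at most [2 tau] is cut off, which leaves enough to go on. *)
Lemma parsed_run R j k : word_root (fac x (cut_pos b) q) \in R ->
  b + (j + k) * q < c1 -> tau <= k * q -> parsed R (b + j * q) (b + (j + k) * q).
Proof.
have q_tau := run_period_le; move=> root_R.
elim/ltn_ind: k j => k IHk j lt_jk ge_k.
have [le_k|gt_k] := leqP (k * q) (4 * tau).
  apply: parsed1; first lia.
  rewrite /piece.
  have -> : cut_pos (b + (j + k) * q) - cut_pos (b + j * q) = k * q.
    by rewrite /cut_pos !edge_run; nia.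
  rewrite fac_run // word_root_pow //; nia.
pose l := (tau %/ q).+1.
have lt_l : tau < l * q by apply: ltn_ceil; case/andP: q_tau.
have le_l : l * q <= tau + q by rewrite /l mulSnr leq_add2r leq_trunc_div.
have lt_lk : l < k by nia.
have def_k : j + k = j + l + (k - l) by lia.
have bnd : b + (j + l) * q < c1 by nia.
apply: (@parsed_cat _ _ (b + (j + l) * q)); [lia | by rewrite def_k; nia | |].
  by apply: IHk; lia.
by rewrite def_k; apply: IHk; nia.
Qed.

End Run.

Section Parsing.
Variable R : seq (seq T).
Hypotheses (R1 : forall c c', marked c -> marked c' -> c + tau <= c' <= c + 8 * tau ->
    word_root (piece c c') \in R)
  (R2 : forall c, marked c -> word_root (piece c (c + 2 * tau)) \in R)
  (R3 : forall c, marked c /\ short_period tau (edge (c + 2 * tau)) ->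
    word_root (fac x (cut_pos (c + 2 * tau)) (run_period c)) \in R)
  (R4 : forall c c' b, marked c -> marked c' -> short_period tau (edge (c + 2 * tau)) ->
    edge b = edge (c + 2 * tau) -> b + 2 * tau <= c' < b + 2 * tau + run_period c ->
    word_root (piece b c') \in R).

(** Far from markers, everything is a run. It is cut at occurrences of its first
window, at distances that are multiples of the period, so that only the piece before
the run and the piece after it are not powers of a conjugate of the period. *)
Lemma parsed_gap c c' : marked c -> marked c' -> c + 8 * tau < c' ->
  (forall i, c + 2 * tau <= i < c' - tau -> short_period tau (edge i)) -> parsed R c c'.
Proof.
move=> mk_c mk_c' lt_cc' sh_gap.
pose b := c + 2 * tau; pose q := run_period c.
have lt_b : b < c' - tau by rewrite /b; lia.
have sh_b : short_period tau (edge b) by apply: sh_gap; lia.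
have q_tau : 0 < q <= tau := run_period_le lt_b sh_gap.
pose k := (c' - 2 * tau - b) %/ q.
have le_k : k * q <= c' - 2 * tau - b by apply: leq_trunc_div.
have lt_k : c' - 2 * tau - b < k * q + q by rewrite -mulSnr ltn_ceil //; lia.
apply: (@parsed_cat _ _ b); [by rewrite /b; lia | by lia | |].
  by apply: parsed1; [rewrite /b; lia | apply: R2].
apply: (@parsed_cat _ _ (b + k * q)); [by lia | by lia | |].
  rewrite -[b in parsed _ b _](addn0) -(mul0n q) -{1}[k]add0n.
  by apply: (parsed_run lt_b sh_gap); [apply: R3 | lia | lia].
apply: parsed1; first lia.
by apply: (R4 mk_c mk_c'); rewrite ?(edge_run lt_b sh_gap) -/b -/q //; lia.
Qed.

(** Cut at the first marker at distance at least [tau], unless this would leave a part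
shorter than [tau]; the last cut is then omitted. *)
Lemma parsed_markers l c c' : marked c -> marked c' -> c + tau <= c' -> c' <= c + l ->
  parsed R c c'.
Proof.
elim/ltn_ind: l c => l IHl c mk_c mk_c' le_cc' le_l.
have [le8|gt8] := leqP c' (c + 8 * tau); first by apply: parsed1; [lia | apply: R1; lia].
pose Q i := (c + tau <= i) && marked i.
have exQ : exists i, Q i by exists c'; rewrite /Q le_cc'.
have [c1 /andP[le_c1 mk_c1] min_c1] := ex_minnP exQ.
have le_c1c' : c1 <= c' by apply: min_c1; rewrite /Q le_cc'.
have sh_gap i : c + 2 * tau <= i < c1 -> short_period tau (edge i).
  move=> lt_i; apply: contraTT isT => nsh.
  have [|j le_j j_E] := E_dense _ nsh; first by have := marked_ge mk_c; lia.
  suff : c1 <= j by lia.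
  by apply: min_c1; rewrite /Q /marked j_E; have := marked_ge mk_c; lia.
have rest c2 : marked c2 -> c + tau <= c2 -> c2 + tau <= c' -> parsed R c c2 ->
    parsed R c c'.
  move=> mk_c2 le_c2 le_c2' par; apply: (parsed_cat le_c2 le_c2' par).
  by apply: (IHl (l - tau)); lia.
have [le_c1'|gt_c1'] := leqP (c1 + tau) c'.
  apply: (rest c1) => //.
  have [le_c18|gt_c18] := leqP c1 (c + 8 * tau); first by apply: parsed1; [lia | apply: R1; lia].
  by apply: parsed_gap => // i lt_i; apply: sh_gap; lia.
by apply: parsed_gap => // i lt_i; apply: sh_gap; lia.
Qed.

End Parsing.

Hypothesis E_infinite : forall j, exists2 i, j <= i & edge i \in E.
Hypothesis x_rec : unif_recurrent x.

(** Two occurrences of one marker are more than [tau] apart, so the parsing applies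
between any two of them, and that marker can take over the role of [z]. *)
Lemma next_level : exists (R W' : seq (seq T)) (z' : seq T) (d' : nat),
  [/\ size R <= size Ws * size E * 9 + size Ws + size Ws + size Ws * size Ws,
    cuts_between x W' z' d', W' != [::] & {in W', forall w, good_word R w}].
Proof.
have [R1 sz_R1 R1P] := roots_between_markers; have [R2 sz_R2 R2P] := roots_after_markers.
have [R3 sz_R3 R3P] := roots_in_runs; have [R4 sz_R4 R4P] := roots_after_runs.
pose R := R1 ++ R2 ++ R3 ++ R4.
have sub1 : {subset R1 <= R} by move=> w; rewrite mem_cat => ->.
have sub2 : {subset R2 <= R} by move=> w; rewrite !mem_cat => ->; rewrite orbT.
have sub3 : {subset R3 <= R} by move=> w; rewrite !mem_cat => ->; rewrite !orbT.
have sub4 : {subset R4 <= R} by move=> w; rewrite !mem_cat => ->; rewrite !orbT.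
pose W' := [seq w <- flatten [seq facs x l | l <- iota 0 (9 * tau).+1] | `[< good_word R w >]].
have mem_W' w : w \in W' <-> good_word R w.
  rewrite mem_filter; split=> [/andP[/asboolP] //|good_w]; apply/andP.
  split; first exact/asboolP.
  have [facs_w le_w _ _] := good_w; apply/flatten_mapP; exists (size w) => //.
  by rewrite mem_iota; lia.
have [c0 le_c0 c0_E] := E_infinite (4 * tau + j0).
pose z' := edge c0; pose d' := sh z' + d.
have W'_cuts : cuts_between x W' z' d'.
  rewrite /cuts_between /z' size_fac; split; first by exists c0.
    by have [] := shP c0; rewrite /d' /z'; lia.
  move=> i j lt_ij z_i z_j.
  have [h rec_i] := x_rec i (j - i + n.+1).
  have [k _ eq_k] := rec_i (4 * tau + j0).
  pose a := 4 * tau + j0 + k; rewrite -/a in eq_k.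
  have e_a : edge a = edge c0.
    by rewrite -z_i -[a]addn0 -[i in RHS]addn0; apply: (eq_sub_fac eq_k); lia.
  have e_b : edge (a + (j - i)) = edge c0.
    by rewrite -z_j -{2}(subnKC (ltnW lt_ij)); apply: (eq_sub_fac eq_k); lia.
  have mk_a : marked a by rewrite /marked e_a c0_E /a; lia.
  have mk_b : marked (a + (j - i)) by rewrite /marked e_b c0_E /a; lia.
  have dist : a + tau < a + (j - i) by apply: (marked_dist mk_a); rewrite ?e_a //; lia.
  have [||||||||ws ws_good def_ws] := @parsed_markers R _ _ _ _ (j - i) a (a + (j - i)) => //.
  - by move=> *; apply/sub1/R1P.
  - by move=> *; apply/sub2/R2P.
  - by move=> *; apply/sub3/R3P.
  - by move=> c *; apply/sub4/(R4P c).
  - exact: ltnW.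
  exists ws; first by move=> w w_ws; apply/mem_W'/ws_good.
  rewrite def_ws /piece /cut_pos e_a e_b -/z' -[a + sh z' + d]addnA -[_ + sh z' + d]addnA -/d'.
  have -> : a + (j - i) + d' - (a + d') = j - i by lia.
  by apply: (eq_sub_fac eq_k); rewrite /d'; have [] := shP c0; rewrite -/z'; lia.
exists R, W', z', d'; split=> //; last by move=> w /mem_W'.
  rewrite !size_cat -!addnA.
  exact: leq_add sz_R1 (leq_add sz_R2 (leq_add sz_R3 sz_R4)).
have [[i1 z1] _ cut] := W'_cuts.
have [h rec] := x_rec i1 (size z'); have [k _ z2] := rec i1.+1.
have [|ws ws_W def_ws] := cut _ _ _ z1 (etrans z2 z1); first lia.
apply/eqP => W'0; have := congr1 size def_ws; rewrite size_fac.
by case: ws ws_W {def_ws} => [_ /=|w ws /(_ w (mem_head _ _))]; [lia | rewrite W'0].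
Qed.

End Cutting.

(** * One step of the tower *)

Lemma size_facsS (T : finType) (x : nat -> T) n :
  size (facs x n) <= size (facs x n.+1).
Proof.
apply: (@leq_size_inj_rel _ _ (fun u v => u = take n v)) => [|_ /facsP[i ->]|].
- exact: facs_uniq.
- by exists (fac x i n.+1); rewrite ?mem_facs ?take_fac.
by move=> u u' v _ _ -> ->.
Qed.

Lemma leq_size_facs (T : finType) (x : nat -> T) m n : m <= n ->
  size (facs x m) <= size (facs x n).
Proof.
elim: n => [|n IHn]; first by rewrite leqn0 => /eqP->.
by rewrite leq_eqVlt => /orP[/eqP-> //|/IHn/leq_trans]; apply; apply: size_facsS.
Qed.

Lemma small_increment (f : nat -> nat) K a l : f (a + l) < l * K.+1 ->
  exists2 n, a <= n < a + l & f n.+1 <= f n + K.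
Proof.
move=> lt_f; apply: contrapT => noP.
suff: l * K.+1 <= f (a + l) by lia.
elim: l {lt_f} noP => [|l IHl] noP; first by rewrite mul0n.
have IH : l * K.+1 <= f (a + l).
  by apply: IHl => -[n lt_n le_f]; apply: noP; exists n => //; lia.
rewrite mulSn addnS leqNgt; apply/negP => lt_f; apply: noP.
by exists (a + l); lia.
Qed.

Section Step.
Variables (T : finType) (x : nat -> T).
Hypotheses (aperiodic : ~ ultimately_periodic x) (x_rec : unif_recurrent x).

(** [e] bounds the number of markers and [w] the number of windows around markers. *)
Definition step_bound K :=
  let e := 16 * K * ((32 * K).*2 + 3) in let w := e * (32 * K) in
  w * e * 9 + w + w + w * w.

Lemma next_level_bounded K W z d : (forall N, exists2 m, N <= m & size (facs x m) <= K * m) ->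
    cuts_between x W z d ->
  forall N, exists W' z' d', [/\ cuts_between x W' z' d', W' != [::],
    forall w, w \in W' -> [/\ w \in facs x (size w), N <= size w
      & exists2 ws, {subset ws <= W} & flatten ws = w],
    {in W' &, forall w w', size w <= 17 * size w'}
    & size (undup (map (@word_root T) W')) <= step_bound K].
Proof.
move=> slow W_cuts N.
have [[iz def_z] _ _] := W_cuts.
have [g z_rec] := x_rec iz (size z); rewrite def_z in z_rec.
have [m le_m slow_m] := slow (16 * ((g + size z).*2 + N.*2 + 1)).
pose tau := m %/ 16.
have tau_m : 16 * tau <= m < 16 * tau + 16.
  by have := divn_eq m 16; have := ltn_pmod m (isT : 0 < 16); rewrite /tau; lia.
have z_tau : (g + size z).*2 <= tau by lia.
have N_tau : N.*2 <= tau by lia.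
have tau_gt0 : 0 < tau by lia.
have le_facs l : l <= m -> size (facs x l) <= 32 * K * tau.
  move=> le_l; apply: leq_trans (leq_size_facs x le_l) (leq_trans slow_m _).
  by rewrite mulnAC mulnC leq_mul2r; lia.
have [|n n_tau le_n] := @small_increment (fun n => size (facs x n)) (16 * K) (2 * tau) (2 * tau).
  by apply: leq_ltn_trans (le_facs _ _) _; [lia | nia].
have tau_n : tau.*2 <= n by lia.
have n_tau' : n < 4 * tau by lia.
have [|E [j0 [sz_E E_long E_dense E_inf]]] := markers tau_gt0 tau_n aperiodic le_n (D := 32 * K).
  by apply: le_facs; lia.
have [Ws [sz_Ws Ws_win]] := windows x tau_gt0 tau_n n_tau' j0 E_long (proj1 (andP tau_m)).
have [sh shP] := shift_exists tau_gt0 tau_n n_tau' W_cuts z_rec z_tau.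
have [per perP] := shortest_period T tau.
have [R [W' [z' [d' [sz_R W'_cuts W'_neq0 W'_good]]]]] := next_level tau_gt0 tau_n n_tau'
  E_long E_dense W_cuts z_tau shP Ws_win perP E_inf x_rec.
have le_Ws : size Ws <= size E * (32 * K).
  by rewrite -(leq_pmul2r tau_gt0) (leq_trans sz_Ws) // -mulnA leq_mul2l le_facs ?orbT.
exists W', z', d'; split=> // [w /W'_good[? ? _ ?]|w w' /W'_good[_ ? _ _] /W'_good[_ ? _ _]|].
- by split=> //; lia.
- by lia.
apply: leq_trans (_ : size R <= _).
  apply: uniq_leq_size (undup_uniq _) _ => r; rewrite mem_undup.
  by case/mapP=> w /W'_good[_ _ ? _] ->.
rewrite /step_bound (leq_trans sz_R) //.
have {}le_Ws := leq_trans le_Ws (leq_mul sz_E (leqnn _)).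
rewrite !leq_add ?leq_mul //.
Qed.

End Step.

(** * Directive sequences from towers of finite sets of words *)

Section Tower.
Variables (T : finType) (T_gt0 : 0 < #|T|) (W : nat -> seq (seq T)).
Hypotheses (W_neq0 : forall n, W n != [::])
  (W_words : forall n w, w \in W n -> w != [::])
  (W_cat : forall n w, w \in W n.+1 -> exists2 ws, {subset ws <= W n} & flatten ws = w).

Let B n : finType := seq_sub (W n).

(* the words over [T] that the letters of the level [n] stand for *)
Let wd n : alphabet T B n -> seq T :=
  match n with 0 => fun a => [:: a] | m.+1 => fun a => ssval a end.

Let split_word n (a : alphabet T B n.+1) :
  exists u : seq (alphabet T B n), flatten (map (@wd n) u) = wd a.
Proof.
case: n a => [|n] a.
  by exists (ssval a); apply: flatten_seq1.
have [ws ws_W def_a] := W_cat (ssvalP a); 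
suff [u def_u] : exists u, flatten (map (@wd n.+1) u) = flatten ws.
  by exists u; rewrite def_u def_a.
move: {a def_a}ws ws_W; elim=> [|w ws IHws] ws_W; first by exists [::].
have [|u def_u] := IHws; first by move=> v v_ws; apply: ws_W; rewrite inE v_ws orbT.
by exists (SeqSub (ws_W w (mem_head _ _)) :: u); rewrite /= -def_u.
Qed.

Lemma sadic_of_tower : exists s : sadic T, forall n,
  (forall a : sadic_alph s n.+1, sadic_word a \in W n) /\
  {in W n, forall w, exists a : sadic_alph s n.+1, sadic_word a = w}.
Proof.
have alph_gt0 n : 0 < #|alphabet T B n|.
  case: n => [|n] //=.
  have w_W : head [::] (W n) \in W n.
    by case: (W n) (W_neq0 n) => //= w ws _; apply: mem_head.
  by apply/card_gt0P; exists (SeqSub w_W).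
pose sigma n (a : alphabet T B n.+1) := projT1 (cid (split_word a)).
have sigmaP n a : flatten (map (@wd n) (sigma n a)) = wd a := projT2 (cid (split_word a)).
have sigma_neq0 n (a : alphabet T B n.+1) : sigma n a != [::].
  have wd_neq0 : wd a != [::] := W_words (ssvalP a).
  by apply: contraNneq wd_neq0 => sigma0; rewrite -sigmaP sigma0.
pose s := @Sadic T B alph_gt0 sigma sigma_neq0.
have prefixP n (u : seq (sadic_alph s n)) : sadic_prefix u = flatten (map (@wd n) u).
  elim: n u => [|n IHn] u /=; first by rewrite flatten_seq1.
  rewrite IHn /word_ext; elim: u => //= a u IHu.
  by rewrite map_cat flatten_cat IHu sigmaP.
have wordP n (a : sadic_alph s n) : sadic_word a = wd a.
  by rewrite /sadic_word prefixP /= cats0.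
exists s => n; split=> [a|w w_W]; first by rewrite wordP; apply: ssvalP.
by exists (SeqSub w_W); rewrite wordP.
Qed.

End Tower.

(** * Compactness and recurrence *)

Section FullShift.
Local Open Scope classical_set_scope.
Variable T : finType.

Lemma full_shift_compact : compact [set: full_shift T].
Proof.
have := @tychonoff int (fun=> discrete_topology T) (fun=> setT).
have -> : [set f : full_shift T | forall i, [set: discrete_topology T] (f i)] = setT.
  by apply/seteqP; split.
apply=> i; apply: finite_compact; exact: (@finite_finset T).
Qed.

Lemma coordinate_continuous (i : int) : continuous (fun z : full_shift T => z i).
Proof. exact: (@proj_continuous int (fun=> discrete_topology T) i). Qed.

Lemma open_coordinate (i : int) (a : T) : open [set z : full_shift T | z i = a].
Proof.
have := @open_comp _ _ (fun z : full_shift T => z i) [set a] _ (discrete_open _).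
by apply=> z _; apply: coordinate_continuous.
Qed.

Lemma size_factor (z : full_shift T) i n : size (factor z i n) = n.
Proof. exact: size_mkseq. Qed.

Lemma eq_factorP (z z' : full_shift T) i j n : factor z i n = factor z' j n <->
  forall k, k < n -> z (i + k%:Z)%R = z' (j + k%:Z)%R.
Proof.
split=> [eq_f k lt_kn | eq_x].
  by have:= congr1 (fun s => nth (z 0%R) s k) eq_f; rewrite !nth_mkseq.
by apply/eq_in_map => k; rewrite mem_iota add0n; apply: eq_x.
Qed.

Lemma near_factor (z : full_shift T) (i : int) (n : nat) :
  nbhs z [set z' | factor z' i n = factor z i n].
Proof.
have near_coord k : nbhs z [set z' : full_shift T | z' (i + k%:Z)%R = z (i + k%:Z)%R].
  by apply: open_nbhs_nbhs; split; first exact: open_coordinate.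
elim: n => [|n IHn].
  by apply: filterS filterT => z' _; apply/eq_factorP.
apply: filterS2 (near_coord n) IHn => z' /= eq_n /eq_factorP eq_z.
by apply/eq_factorP => k; rewrite ltnS leq_eqVlt => /orP[/eqP-> //|]; apply: eq_z.
Qed.

Lemma open_factor (P : seq T -> Prop) (i : int) (n : nat) :
  open [set z : full_shift T | P (factor z i n)].
Proof.
rewrite openE => z Pz; rewrite /interior /=.
by apply: filterS (near_factor z i n) => z' /= ->.
Qed.

Lemma closed_factor (P : seq T -> Prop) (i : int) (n : nat) :
  closed [set z : full_shift T | P (factor z i n)].
Proof.
rewrite -[X in closed X]setCK; apply: open_closedC.
exact: (open_factor (fun w => ~ P w)).
Qed.

Lemma closed_nested (Z : nat -> set (full_shift T)) :
    (forall g, closed (Z g)) -> (forall g, Z g !=set0) ->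
    (forall g, Z g.+1 `<=` Z g) ->
  exists z, forall g, Z g z.
Proof.
move=> Zcl Zn0 Zdec.
have Zle g h : g <= h -> Z h `<=` Z g.
  elim: h => [|h IHh]; first by rewrite leqn0 => /eqP->.
  by rewrite leq_eqVlt => /orP[/eqP-> //|/IHh]; apply: subset_trans.
pose F := filter_from [set: nat] Z.
have FF : ProperFilter F.
  apply: filter_from_proper => [|g _]; last exact: Zn0.
  apply: filter_from_filter; first by exists 0.
  move=> g h _ _; exists (maxn g h) => // z Zz.
  by split; apply: Zle Zz; rewrite ?leq_maxl ?leq_maxr.
have [|z [_ clz]] := full_shift_compact FF; first exact: filterT.
exists z => g; move: clz; rewrite clusterE => /(_ (Z g)).
by move=> clZ; apply: Zcl; apply: clZ; exists g.
Qed.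

End FullShift.

Section Subshift.
Local Open Scope classical_set_scope.
Variables (T : finType) (X : set (full_shift T)).
Hypothesis subX : subshift X.

Lemma subshift_shift (k : int) z : X z -> X (fun n => z (n + k)%R).
Proof.
have [_ shX] := subX.
have step y : X y -> X (fun n => y (n + 1)%R) by rewrite -{2}shX; exists y.
have back y : X y -> X (fun n => y (n - 1)%R).
  rewrite -{1}shX => -[u Xu <-]; rewrite /shift.
  suff -> : (fun n => u (n - 1 + 1)%R) = u by [].
  by apply: funext => n; congr u; lia.
have pos (m : nat) y : X y -> X (fun n => y (n + m%:Z)%R).
  elim: m y => [|m IHm] y Xy.
    by have -> : (fun n => y (n + 0%:Z)%R) = y by apply: funext => n; congr y; lia.
  have -> : (fun n => y (n + m.+1%:Z)%R) = (fun n => (fun n' => y (n' + 1)%R) (n + m%:Z)%R).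
    by apply: funext => n; congr y; lia.
  exact: (IHm (fun n' => y (n' + 1)%R) (step y Xy)).
have neg (m : nat) y : X y -> X (fun n => y (n - m%:Z)%R).
  elim: m y => [|m IHm] y Xy.
    by have -> : (fun n => y (n - 0%:Z)%R) = y by apply: funext => n; congr y; lia.
  have -> : (fun n => y (n - m.+1%:Z)%R) = (fun n => (fun n' => y (n' - 1)%R) (n - m%:Z)%R).
    by apply: funext => n; congr y; lia.
  exact: (IHm (fun n' => y (n' - 1)%R) (back y Xy)).
case: (intP k) => [|m|m] Xz.
- exact: (pos 0 z Xz).
- exact: (pos m.+1 z Xz).
- exact: (neg m.+1 z Xz).
Qed.

Lemma factor_shift (z : full_shift T) k i n :
  factor ((fun m => z (m + k)%R) : full_shift T) i n = factor z (i + k)%R n.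
Proof. by apply/eq_factorP => l _; congr z; lia. Qed.

(** A point that contains a central factor of [z] can be shifted to agree with [z] around
the origin, and compactness provides a point agreeing with [z] everywhere. *)
Lemma subshift_factors (z : full_shift T) :
    (forall l : nat, exists2 y, X y &
       exists i, factor y i (l + l) = factor z (- l%:Z)%R (l + l)) ->
  X z.
Proof.
move=> zP; have [clX _] := subX.
pose Z (g : nat) := X `&` [set y | factor y (- g%:Z)%R (g + g) = factor z (- g%:Z)%R (g + g)].
have [||| y Zy] := @closed_nested T Z.
- move=> g; apply: closedI => //.
  exact: (@closed_factor T (fun w => w = factor z (- g%:Z)%R (g + g)) (- g%:Z)%R (g + g)).
- move=> g; have [y Xy [i eq_y]] := zP g.
  exists (fun m => y (m + (i + g%:Z))%R); split; first exact: subshift_shift.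
  by rewrite /= factor_shift -eq_y; congr factor; lia.
- move=> g y [Xy /= /eq_factorP eq_y]; split=> //=; apply/eq_factorP => k lt_k.
  have eq_i : (- g.+1%:Z + k.+1%:Z = - g%:Z + k%:Z)%R by lia.
  by have := eq_y k.+1; rewrite eq_i; apply; lia.
suff -> : z = y by case: (Zy 0).
apply: funext => i; have [_ /eq_factorP eq_y] := Zy `|i|.+1.
have := eq_y (absz (i + (absz i).+1%:Z)%R).
have -> : (- (absz i).+1%:Z + (absz (i + (absz i).+1%:Z))%:Z = i)%R by lia.
by move=> -> //; lia.
Qed.

End Subshift.

(** Otherwise, by compactness, some point of [X] avoids the given factor, and the
points of [X] that avoid it form a nonempty closed invariant subset other than [X]. *)
Lemma minimal_recurrent (T : finType) (X : set (full_shift T)) (y : full_shift T)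
    (i : int) (n : nat) : minimal_subshift X -> X y ->
  exists g, forall z (j : int), X z ->
    exists2 k : nat, k < g & factor z (j + k%:Z)%R n = factor y i n.
Proof.
move=> [subX _ minX] Xy; set w := factor y i n; apply: contrapT => noP.
have avoid g : exists2 z, X z & forall k : nat, k < g + g ->
    factor z (- g%:Z + k%:Z)%R n <> w.
  apply: contrapT => no_z; apply: noP; exists (g + g) => z j Xz.
  apply: contrapT => no_k; apply: no_z.
  exists (fun m => z (m + (j + g%:Z))%R); first exact: (subshift_shift subX).
  move=> k lt_k; rewrite factor_shift => eq_w; apply: no_k; exists k => //.
  by rewrite -eq_w; congr factor; lia.
pose Y := (X `&` \bigcap_(j in [set: int]) [set z | factor z j n <> w])%classic.
pose Z (g : nat) := (X `&` \bigcap_(k in [set k : nat | k < g + g])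
  [set z | factor z (- g%:Z + k%:Z)%R n <> w])%classic.
have clY : closed Y.
  apply: closedI; first by case: subX.
  by apply: closed_bigI => j _; exact: (@closed_factor T (fun u => u <> w) j n).
have shY : (@shift T @` Y = Y)%classic.
  apply/seteqP; split=> z.
    case=> u [Xu avu] <-; split; first exact: (subshift_shift subX 1 Xu).
    by move=> j _ /=; rewrite factor_shift; apply: avu.
  move=> [Xz avz]; exists (fun m => z (m + -1)%R); last first.
    by apply: funext => m; rewrite /shift; congr z; lia.
  split; first exact: (subshift_shift subX (-1) Xz).
  by move=> j _ /=; rewrite factor_shift; apply: avz.
case: (minX Y _ clY shY); first by move=> z [].
  have [||| z Zz] := @closed_nested T Z.
  - move=> g; apply: closedI; first by case: subX.
    by apply: closed_bigI => k _; exact: (@closed_factor T (fun u => u <> w) (- g%:Z + k%:Z)%R n).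
  - by move=> g; have [z Xz av] := avoid g; exists z; split.
  - move=> g z [Xz av]; split=> // k lt_k /=.
    have := av k.+1; have -> : (- g.+1%:Z + k.+1%:Z = - g%:Z + k%:Z)%R by lia.
    by apply; move: lt_k => /=; lia.
  move=> Y0; suff : Y z by rewrite Y0.
  split=> [|j _ /=]; first by case: (Zz 0).
  have [_ av] := Zz (absz j).+1.
  have := av (absz (j + (absz j).+1%:Z)%R).
  have -> : (- (absz j).+1%:Z + (absz (j + (absz j).+1%:Z))%:Z = j)%R by lia.
  by apply=> /=; lia.
move=> YX; have : Y y by rewrite YX.
by case=> _ /(_ i I).
Qed.

Import Order.TTheory GRing.Theory Num.Theory.



(** * Nonsuperlinear growth *)

Lemma limn_einf_ratio_lty (R : realType) (f : nat -> nat) :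
  (limn_einf (fun n : nat => ((f n)%:R / n%:R : R)%:E) < +oo)%E <->
  exists K, forall N, exists2 m, N <= m & f m <= K * m.
Proof.
set u := (X in limn_einf X).
have -> : limn_einf u = ereal_sup (range (einfs u)).
  by rewrite limn_einf_lim; apply/cvg_lim => //; apply: cvg_einfs_sup.
split=> [lt_sup|[K slow]].
  apply: contrapT => noK.
  have large K : (K%:R%:E <= ereal_sup (range (einfs u)))%E.
    have [N N_large] : exists N, forall m, N <= m -> K * m < f m.
      apply: contrapT => noN; apply: noK; exists K => N.
      apply: contrapT => no_m; apply: noN; exists N => m le_m.
      by rewrite ltnNge; apply/negP => le_f; apply: no_m; exists m.
    apply: (@le_trans _ _ (einfs u N.+1)); last by apply: ereal_sup_ubound; exists N.+1.
    apply: le_ereal_inf_tmp => _ [m /= lt_m <-]; rewrite lee_fin.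
    rewrite ler_pdivlMr ?ltr0n; last by case: m lt_m.
    by rewrite -natrM ler_nat ltnW // N_large // ltnW.
  have /fineK fin : ereal_sup (range (einfs u)) \is a fin_num.
    by rewrite fin_numE gt_eqF ?(lt_le_trans (ltNyr _) (large 0)) // lt_eqF.
  have := large (Num.truncn (fine (ereal_sup (range (einfs u))))).+1.
  rewrite -fin lee_fin leNgt; case/negP.
  exact: truncnS_gt.
apply: (@le_lt_trans _ _ (K%:R%:E)); last exact: ltry.
apply: ge_ereal_sup => _ [n _ <-].
have [m le_m le_f] := slow n.+1.
apply: (@le_trans _ _ (u m)); first by apply: ereal_inf_lbound; exists m => //=; exact: ltnW.
rewrite lee_fin ler_pdivrMr ?ltr0n; last by case: m le_m {le_f}.
by rewrite -natrM ler_nat.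
Qed.

(** * Words read off concatenations of boundedly many periodic words *)

Lemma take_eq_root (T : eqType) (s s' : seq T) m : word_root s = word_root s' ->
  m <= size s -> m <= size s' -> take m s = take m s'.
Proof.
have [k _ def_s] := word_rootP s; have [k' _ def_s'] := word_rootP s'.
move=> eq_r; rewrite -{}eq_r in def_s'.
move: (word_root s) def_s def_s' => r -> ->; rewrite !size_word_pow.
wlog le_kk' : k k' / k <= k' => [th|] le_m le_m'.
  by case/orP: (leq_total k k') => le_k; [apply: th | apply/esym/th].
by rewrite -(subnKC le_kk') word_powD takel_cat // size_word_pow.
Qed.

Lemma drop_eq_root (T : eqType) (s s' : seq T) m : word_root s = word_root s' ->
  m <= size s -> m <= size s' -> drop (size s - m) s = drop (size s' - m) s'.
Proof.
have [k _ def_s] := word_rootP s; have [k' _ def_s'] := word_rootP s'.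
move=> eq_r; rewrite -{}eq_r in def_s'.
move: (word_root s) def_s def_s' => r -> ->; rewrite !size_word_pow.
wlog le_kk' : k k' / k <= k' => [th|] le_m le_m'.
  by case/orP: (leq_total k k') => le_k; [apply: th | apply/esym/th].
rewrite -[in word_pow r k'](subnK le_kk') word_powD drop_cat size_word_pow.
case: ltnP => [|_]; first by nia.
by congr drop; nia.
Qed.

Lemma take_cat_take (A : Type) m (a b : seq A) : m <= size b ->
  take m (a ++ b) = take m (a ++ take m b).
Proof.
move=> le_mb; rewrite -{1}(cat_take_drop m b) catA takel_cat // size_cat.
by rewrite size_takel // leq_addl.
Qed.

Lemma window_in_two_words (T : eqType) (S : seq (seq T)) m ss p :
    0 < m -> {in S, forall s, m <= size s} -> {subset ss <= S} ->
    p + m <= size (flatten ss) ->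
  exists s1 s2 o, [/\ s1 \in S, s2 \in S, o <= size s1
    & take m (drop p (flatten ss)) = take m (drop o (s1 ++ s2))].
Proof.
move=> m_gt0 S_ge; elim: ss p => [|s ss IHss] p ss_S; first by rewrite /=; lia.
have s_S : s \in S by apply: ss_S; rewrite mem_head.
have {}ss_S : {subset ss <= S} by move=> v v_ss; apply: ss_S; rewrite inE v_ss orbT.
rewrite /= size_cat => le_pm; have [le_ps|lt_sp] := leqP p (size s); last first.
  by rewrite drop_cat ltnNge ltnW //=; apply: IHss => //; lia.
have drop_s (u : seq T) : drop p (s ++ u) = drop p s ++ u.
  rewrite drop_cat; case: ltnP => // le_sp.
  have -> : p = size s by apply/eqP; rewrite eqn_leq le_ps.
  by rewrite subnn drop0 drop_size.
case: ss {IHss} ss_S le_pm => [|s' ss] ss_S /= le_pm.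
  exists s, s, p; split=> //; rewrite cats0 drop_s takel_cat // size_drop.
  by move: le_pm; lia.
have s'_S : s' \in S by apply: ss_S; rewrite mem_head.
exists s, s', p; split=> //; rewrite !drop_s catA takel_cat // size_cat.
by rewrite (leq_trans (S_ge _ s'_S)) ?leq_addl.
Qed.

(** A window of length [m] in a concatenation of words of length between [m] and
[D m] straddles at most one boundary, and it is determined by its distance to that
boundary and by the roots of the two words around it. *)
Lemma few_windows (T : eqType) (S : seq (seq T)) m D : 0 < m ->
    {in S, forall s, m <= size s <= D * m} ->
    size (undup (map (@word_root T) S)) <= D ->
  exists2 L : seq (seq T), size L <= D * D * (D * m).+1 &
    forall ss p, {subset ss <= S} -> p + m <= size (flatten ss) ->
      take m (drop p (flatten ss)) \in L.
Proof.
move=> m_gt0 S_size; set Rt := undup _ => sz_Rt.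
pose P (q : seq T * seq T * nat) := [/\ q.1.1 \in S, q.1.2 \in S & q.2 <= size q.1.1].
pose code (q : seq T * seq T * nat) :=
  (word_root q.1.1, word_root q.1.2, size q.1.1 - q.2).
pose f (q : seq T * seq T * nat) := take m (drop q.2 (q.1.1 ++ q.1.2)).
have [||L sz_L L_P] := @cover_by_codes _ _ _ P code f
    (allpairs pair (allpairs pair Rt Rt) (iota 0 (D * m).+1)).
- move=> [[s1 s2] o]; rewrite /P /code /fst /snd => -[s1_S s2_S le_o].
  apply: (allpairs_f pair).
    by apply: (allpairs_f pair); rewrite mem_undup map_f.
  by rewrite mem_iota; have := S_size _ s1_S; lia.
- move=> [[s1 s2] o] [[s1' s2'] o'] [/= s1_S s2_S le_o] [/= s1'_S s2'_S le_o'] eq_c.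
  have eq_r1 : word_root s1 = word_root s1' := congr1 (fun p => p.1.1) eq_c.
  have eq_r2 : word_root s2 = word_root s2' := congr1 (fun p => p.1.2) eq_c.
  have eq_o : size s1 - o = size s1' - o' := congr1 snd eq_c.
  have drop_le (u v : seq T) i : i <= size u -> drop i (u ++ v) = drop i u ++ v.
    move=> le_i; rewrite drop_cat; case: ltnP => // le_ui.
    have -> : i = size u by apply/eqP; rewrite eqn_leq le_i.
    by rewrite subnn drop0 drop_size.
  have /andP[le2 _] := S_size _ s2_S; have /andP[le2' _] := S_size _ s2'_S.
  rewrite /f /= !drop_le // (take_cat_take _ le2) (take_cat_take _ le2').
  rewrite (take_eq_root eq_r2 le2 le2'); congr (take m (_ ++ _)).
  have := @drop_eq_root _ s1 s1' (size s1 - o) eq_r1 (leq_subr _ _).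
  by rewrite subKn // eq_o subKn // leq_subr; apply.
rewrite !size_allpairs size_iota in sz_L.
exists L; first by rewrite (leq_trans sz_L) // leq_mul // leq_mul.
move=> ss p ss_S le_pm.
have S_ge : {in S, forall s, m <= size s} by move=> s /S_size /andP[].
have [s1 [s2 [j [s1_S s2_S le_j eq_w]]]] := window_in_two_words m_gt0 S_ge ss_S le_pm.
by rewrite eq_w; apply: (L_P (s1, s2, j)).
Qed.

(** * Directive sequences generate subshifts of nonsuperlinear growth *)

Section SadicWords.
Variables (T : finType) (s : sadic T).

Lemma sadic_prefix_flatten n (u : seq (sadic_alph s n)) :
  sadic_prefix u = flatten (map (@sadic_word T s n) u).
Proof.
have prefix_cat k (v w : seq (sadic_alph s k)) :
    sadic_prefix (v ++ w) = sadic_prefix v ++ sadic_prefix w.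
  by elim: k v w => //= k IHk v w; rewrite /word_ext map_cat flatten_cat IHk.
have prefix_nil k : sadic_prefix ([::] : seq (sadic_alph s k)) = [::].
  by elim: k.
by elim: u => [|a u IHu] //=; rewrite -cat1s prefix_cat IHu.
Qed.

Lemma sadic_word_flatten n N (a : sadic_alph s N) : n <= N ->
  exists u : seq (sadic_alph s n), sadic_word a = flatten (map (@sadic_word T s n) u).
Proof.
move=> le_nN.
suff [u def_u] : exists u : seq (sadic_alph s n), sadic_word a = sadic_prefix u.
  by exists u; rewrite def_u sadic_prefix_flatten.
rewrite /sadic_word; move: [:: a]; elim: N le_nN {a} => [|N IHN].
  by rewrite leqn0 => /eqP-> v; exists v.
rewrite leq_eqVlt => /orP[/eqP-> v|le_nN v]; first by exists v.
by have [u] := IHN le_nN (word_ext (@sadic_map T s N) v); exists u.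
Qed.

Lemma bounded_below_level n : exists M, forall k (a : sadic_alph s k),
  k < n -> size (sadic_word a) <= M.
Proof.
elim: n => [|n [M leM]]; first by exists 0.
exists (M + \sum_(a : sadic_alph s n) size (sadic_word a)) => k a.
rewrite ltnS leq_eqVlt => /orP[/eqP eq_kn|/leM/leq_trans]; last by apply; apply: leq_addr.
by case: n / eq_kn leM => _; rewrite (bigD1 a) //= addnCA leq_addr.
Qed.

End SadicWords.

Lemma infix_window (T : eqType) (w v : seq T) : infix w v ->
  exists2 p, p + size w <= size v & w = take (size w) (drop p v).
Proof.
case/infixP=> a [b ->]; exists (size a); first by rewrite !size_cat; lia.
by rewrite drop_size_cat // take_size_cat.
Qed.

Lemma sadic_slow (T : finType) (s : sadic T) (D : nat) : 0 < D ->
    (sadic_subshift s !=set0)%classic ->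
    (forall n, size (undup (map (@word_root T)
        [seq sadic_word a | a <- enum (sadic_alph s n)])) <= D) ->
    (forall n (a b : sadic_alph s n), size (sadic_word a) <= D * size (sadic_word b)) ->
  forall N, exists2 m, N <= m &
    complexity (sadic_subshift s) m <= D * D * (D * m).+1.
Proof.
move=> D_gt0 [x0 Xx0] roots_D size_D N.
have [n _ [a0 a0_long]] := Xx0 (D * N.+1).
have n_long (b : sadic_alph s n) : N < size (sadic_word b).
  have := size_infix a0_long; rewrite size_factor => le_a0.
  by have := leq_trans le_a0 (size_D n a0 b); nia.
have exm : exists m, [exists b : sadic_alph s n, size (sadic_word b) == m].
  by exists (size (sadic_word a0)); apply/existsP; exists a0.
have [m /existsP[a /eqP def_m] min_m] := ex_minnP exm.
have min_a (b : sadic_alph s n) : m <= size (sadic_word b).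
  by apply: min_m; apply/existsP; exists b.
have lt_Nm : N < m by rewrite -def_m.
have m_gt0 : 0 < m by lia.
exists m; first exact: ltnW.
pose S := [seq sadic_word b | b <- enum (sadic_alph s n)].
have S_size : {in S, forall w, m <= size w <= D * m}.
  by move=> _ /mapP[b _ ->]; rewrite min_a; have := size_D n b a; rewrite def_m.
have [L sz_L L_P] := few_windows m_gt0 S_size (roots_D n).
apply: leq_trans sz_L; rewrite /complexity cardE.
rewrite -(size_map val); apply: uniq_leq_size.
  by rewrite map_inj_uniq ?enum_uniq //; apply: val_inj.
move=> _ /mapP[w + ->]; rewrite mem_enum => /asboolP[x Xx [i def_w]].
have [M leM] := bounded_below_level s n.
pose l := (absz i + m + M).+1.
have [n' _ [b b_long]] := Xx l.
have le_nn' : n <= n'.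
  rewrite leqNgt; apply/negP => /(leM _ b) le_b.
  by have := leq_trans (size_infix b_long) le_b; rewrite size_factor /l; lia.
have [u def_b] := sadic_word_flatten b le_nn'.
have w_l : infix w (factor x (- l%:Z)%R (l + l)).
  have -> : l + l = absz (i + l%:Z)%R + (m + (l + l - absz (i + l%:Z)%R - m)).
    by rewrite /l; lia.
  rewrite /factor /mkseq !iotaD !map_cat; apply/infixP.
  eexists; eexists; congr (_ ++ (_ ++ _)).
  rewrite -def_w /factor /mkseq add0n -[in LHS](addn0 (absz (i + l%:Z)%R)) iotaDl -map_comp.
  by apply: eq_map => k /=; congr x; rewrite /l; lia.
have [p le_p def_p] := infix_window (infix_trans w_l b_long).
rewrite size_tuple def_b in le_p def_p; rewrite -[val w]/(tval w) def_p.
by apply: L_P => // v /mapP[c _ ->]; apply: map_f; rewrite mem_enum.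
Qed.

(** * Towers *)

(** The set [W n] is meant for the level [n.+1], the level [0] being the alphabet. The
constant [17] comes from words of lengths between [tau / 2] and [17 tau / 2]. *)
Definition tower (T : finType) (x : nat -> T) (C : nat) (W : nat -> seq (seq T)) :=
  forall n, [/\ W n != [::],
    {in W n, forall w, w \in facs x (size w) /\ n < size w},
    {in W n.+1, forall w, exists2 ws, {subset ws <= W n} & flatten ws = w},
    {in W n &, forall w w', size w <= 17 * size w'}
    & size (undup (map (@word_root T) (W n))) <= C].

Section Towers.
Variables (T : finType) (x : nat -> T).
Hypothesis x_rec : unif_recurrent x.

Lemma tower_periodic : ultimately_periodic x -> exists C W, tower x C W.
Proof.
case=> c [c_gt0 [t per_t]].
have per i : x (i + c) = x i.
  have [g rec_g] := x_rec i c.+1; have [k _ /eq_facP eq_x] := rec_g t.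
  by rewrite -eq_x // -[i in RHS]addn0 -eq_x // addn0 -(per_t (t + k)) ?leq_addr.
have perM k i : x (i + k * c) = x i.
  by elim: k i => [|k IHk] i; rewrite ?addn0 // mulSn addnA IHk per.
exists 1, (fun n => [:: fac x 0 (2 ^ n * c)]) => n; split=> //.
- move=> _ /[1!inE] /eqP ->; rewrite size_fac mem_facs; split=> //.
  by have := ltn_expl n (isT : 1 < 2); nia.
- move=> _ /[1!inE] /eqP ->; exists (nseq 2 (fac x 0 (2 ^ n * c))).
    by move=> w; rewrite !inE orbb.
  rewrite /= cats0 expnS -mulnA mul2n -addnn facD; congr (_ ++ _).
  by apply/eq_facP => k _; rewrite addnAC perM.
- by move=> _ _ /[1!inE] /eqP -> /[1!inE] /eqP ->; rewrite leq_pmull.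
Qed.

Lemma tower_aperiodic K : ~ ultimately_periodic x ->
    (forall N, exists2 m, N <= m & size (facs x m) <= K * m) ->
  exists C W, tower x C W.
Proof.
move=> aper slow.
pose level := (seq (seq T) * seq T * nat)%type.
pose cuts (l : level) := cuts_between x l.1.1 l.1.2 l.2.
have [next nextP] : exists next : level * nat -> level, forall p, cuts p.1 ->
  [/\ cuts (next p), (next p).1.1 != [::],
    forall w, w \in (next p).1.1 -> [/\ w \in facs x (size w), p.2 <= size w
      & exists2 ws, {subset ws <= p.1.1.1} & flatten ws = w],
    {in (next p).1.1 &, forall w w', size w <= 17 * size w'}
    & size (undup (map (@word_root T) (next p).1.1)) <= step_bound K].
  suff /choice[next nextP] : forall p : level * nat, exists l : level, cuts p.1 ->
      [/\ cuts l, l.1.1 != [::],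
      forall w, w \in l.1.1 -> [/\ w \in facs x (size w), p.2 <= size w
        & exists2 ws, {subset ws <= p.1.1.1} & flatten ws = w],
      {in l.1.1 &, forall w w', size w <= 17 * size w'}
      & size (undup (map (@word_root T) l.1.1)) <= step_bound K] by exists next.
  move=> [[[W z] d] N]; have [cutsW|nocuts] := pselect (cuts (W, z, d)); last first.
    by exists (W, z, d).
  have [W' [z' [d' W'P]]] := next_level_bounded aper x_rec slow cutsW N.
  by exists (W', z', d').
pose l0 : level := ([seq [:: a] | a <- enum T], [::], 0).
pose fix lev n := if n is m.+1 then next (lev m, m.+1) else l0.
have cuts_lev n : cuts (lev n).
  elim: n => [|n IHn]; last by case: (nextP (lev n, n.+1) IHn).
  split=> //=; first by exists 0.
  move=> i j _ _ _; exists [seq [:: a] | a <- fac x i (j - i)].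
    by move=> _ /mapP[a _ ->]; apply: map_f; rewrite mem_enum.
  by rewrite flatten_seq1 addn0.
exists (step_bound K), (fun n => (lev n.+1).1.1) => n.
have [_ n_neq0 n_words n_size n_root] := nextP (lev n, n.+1) (cuts_lev n).
split=> // [w /n_words[]//|w w_n].
by have [_ _ /(_ w w_n)[]] := nextP (lev n.+1, n.+2) (cuts_lev n.+1).
Qed.

End Towers.

(** * The characterization *)

Lemma card_roots_of_level (T : finType) (s : sadic T) n :
  #|` roots_of_level s n|%fset =
    size (undup (map (@word_root T) [seq sadic_word a | a <- enum (sadic_alph s n)])).
Proof.
apply: perm_size; apply: uniq_perm; rewrite ?undup_uniq ?fset_uniq // => r.
rewrite mem_undup -map_comp; apply/imfsetP/mapP => -[a _ ->]; exists a => //=.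
by rewrite mem_enum.
Qed.

Section Minimal.
Variables (T : finType) (X : set (full_shift T)) (x : full_shift T).
Hypotheses (X_min : minimal_subshift X) (Xx : X x).

Let xn (k : nat) : T := x k%:Z%R.

Let fac_factor i n : fac xn i n = factor x i%:Z%R n.
Proof. by apply/eq_in_map => k _; rewrite /xn PoszD. Qed.

Let factor_recurs z (i : int) n : X z -> exists g, forall j, exists2 k, k < g &
  fac xn (j + k) n = factor z i n.
Proof.
move=> Xz; have [g rec_g] := @minimal_recurrent _ X z i n X_min Xz.
exists g => j; have [k lt_k eq_k] := rec_g x j%:Z%R Xx.
by exists k; rewrite // fac_factor PoszD.
Qed.

Lemma half_line_recurrent : unif_recurrent xn.
Proof. by move=> i n; rewrite fac_factor; apply: factor_recurs. Qed.

Lemma complexity_half_line n : complexity X n = size (facs xn n).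
Proof.
rewrite size_map -cardE; apply: eq_card => w; rewrite !inE.
apply/asboolP/asboolP => [[z Xz [i <-]]|[i eq_w]].
  by have [g rec_g] := factor_recurs i n Xz; have [k _ eq_k] := rec_g 0; exists (0 + k).
by exists x => //; exists i%:Z%R; rewrite -fac_factor.
Qed.

(** By recurrence every factor of [X] occurs in all long factors, and the words of the
tower are arbitrarily long factors. *)
Lemma tower_generates C W : 0 < #|T| -> tower xn C W ->
  exists2 s : sadic T, generates s X & forall n,
    size (undup (map (@word_root T) [seq sadic_word a | a <- enum (sadic_alph s n)]))
      <= maxn C #|T| /\
    forall a b : sadic_alph s n, size (sadic_word a) <= 17 * size (sadic_word b).
Proof.
move=> T_gt0 W_tower.
have W_neq0 n : W n != [::] by case: (W_tower n).
have W_facs n : {in W n, forall w, w \in facs xn (size w) /\ n < size w}.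
  by case: (W_tower n).
have W_words n w : w \in W n -> w != [::].
  by case/W_facs=> _; case: w.
have W_cat n w : w \in W n.+1 -> exists2 ws, {subset ws <= W n} & flatten ws = w.
  by case: (W_tower n) => _ _ cat_n _ _; apply: cat_n.
have [s sP] := sadic_of_tower T_gt0 W_neq0 W_words W_cat.
have subX : subshift X by case: X_min.
exists s.
  apply/seteqP; split=> z.
    move=> Xz; apply: (subshift_factors subX) => l; exists x => //.
    have [[//|n] _ [a a_l]] := Xz l.
    have [/(_ a) /W_facs[/facsP[i def_a] _] _] := sP n.
    have [p] := infix_window a_l; rewrite size_factor => le_p ->.
    exists (i + p)%:Z%R; rewrite def_a drop_fac take_fac; last lia.
    by rewrite fac_factor.
  move=> Xz l; have [g rec_g] := factor_recurs (- l%:Z)%R (l + l) Xz.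
  pose n := g + (l + l); exists n.+1 => //.
  have w_n : head [::] (W n) \in W n.
    by case: (W n) (W_neq0 n) => //= w ws _; apply: mem_head.
  have [[/facsP[i def_w] lt_n] [_ /(_ _ w_n)[a def_a]]] := (W_facs _ _ w_n, sP n).
  exists a; rewrite def_a def_w; have [k lt_k <-] := rec_g i.
  set N := size _ in lt_n *; have -> : N = k + (l + l + (N - k - (l + l))).
    by rewrite /n in lt_n; lia.
  by rewrite !facD; apply: infix_catl; apply: prefix_infix; apply: prefix_prefix.
case=> [|n].
  split=> //; apply: leq_trans (size_undup _) _; rewrite 2!size_map.
  by apply: leq_trans (leq_maxr C _); rewrite cardE.
have [sW _] := sP n; have [_ _ _ ratio roots] := W_tower n.
split=> [|a b]; last exact: ratio.
rewrite leq_max (leq_trans _ roots) //; apply: uniq_leq_size (undup_uniq _) _ => r.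
rewrite !mem_undup -map_comp => /mapP[a _ ->] /=.
by apply: map_f; apply: sW.
Qed.

End Minimal.

Local Open Scope ring_scope.

Theorem theorem2 (R : realType) (T : finType) (hT : (0 < #|T|)%N)
    (X : set (full_shift T)) (hX : minimal_subshift X) :
  nonsuperlinear_complexity R X <->
  exists (d : R) (s : sadic T),
    [/\ 0 < d, generates s X
      & forall n : nat,
          (#|` roots_of_level s n|%:R <= d) /\
          (forall a b : sadic_alph s n,
             (size (sadic_word a))%:R <= d * (size (sadic_word b))%:R)].
Proof.
have [_ [x Xx] _] := hX; split.
  move=> /limn_einf_ratio_lty[K slow].
  have rec := half_line_recurrent hX Xx.
  have [C [W WP]] : exists C W, tower (fun k : nat => x k%:Z) C W.
    have [per|aper] := pselect (ultimately_periodic (fun k : nat => x k%:Z)).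
      exact: tower_periodic rec per.
    apply: (tower_aperiodic rec aper (K := K)) => N; have [m le_m slow_m] := slow N.
    by exists m; rewrite // -(complexity_half_line hX Xx).
  have [s s_gen sP] := tower_generates hX Xx hT WP.
  pose d := maxn 17 (maxn C #|T|).
  exists d%:R, s; split=> // [|n]; first by rewrite ltr0n /d; lia.
  have [roots ratio] := sP n; rewrite card_roots_of_level ler_nat; split.
    by rewrite (leq_trans roots) ?leq_maxr.
  by move=> a b; rewrite -natrM ler_nat (leq_trans (ratio a b)) // leq_mul2r leq_maxl orbT.
case=> d [s [d_gt0 s_gen sP]]; apply/limn_einf_ratio_lty.
pose D := (Num.truncn d).+1; have lt_dD : d < D%:R by apply: truncnS_gt.
exists (D * D * D.+1)%N => N.
have [|||m le_m slow_m] := @sadic_slow _ s D isT _ _ _ N.+1.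
- by rewrite s_gen; exists x.
- move=> n; rewrite -card_roots_of_level -(ler_nat R).
  by apply: le_trans (ltW lt_dD); case: (sP n).
- move=> n a b; rewrite -(ler_nat R) natrM.
  have [_ /(_ a b)/le_trans] := sP n; apply.
  by rewrite ler_wpM2r // ltW.
exists m; first exact: ltnW.
rewrite s_gen in slow_m; apply: leq_trans slow_m _.
by rewrite -[leqRHS]mulnA leq_mul // mulSn -add1n leq_add2r; apply: leq_trans le_m.
Qed.
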